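(* For every $\epsilon>0$ there exist increasing sequences of positive integers $(n_i)$ and $(n_j)$ such that $$\lim_{i\to\infty}\mathbb{P}\left(\tfrac12 n_i\log n_i< \omega_{n_i} < (\tfrac12 +\epsilon) n_i\log n_i\right)= 1$$ and $$\lim_{j\to\infty}\mathbb{P}\left(n_j\log n_j < \omega_{n_j} < (1+\epsilon)n_j\log n_j\right)= 1.$$ In particular, the constants $\frac12$ and $1+\epsilon$ in the statement $\lim_{n\to\infty}\mathbb{P}(\frac12 n\log n<\omega_n<(1+\epsilon)n\log n)=1$ cannot be improved.
   Context: All logarithms are base $2$. For a positive integer $n$, the random Cayley sum graph on $\mathbb{F}_2^n$ is constructed as follows: choose a random subset $A\subset\mathbb{F}_2^n$ by including each element independently with probability $\frac12$; the graph has vertex set $\mathbb{F}_2^n$, and distinct vertices $x\neq y$ are adjacent if and only if $x+y\in A$. $\omega_n$ denotes the clique number of this random graph. *)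

(* Defs.v *)
From mathcomp Require Import all_boot all_order all_algebra.
From mathcomp Require Import all_classical all_reals all_analysis.

Set Implicit Arguments.
Unset Strict Implicit.
Unset Printing Implicit Defensive.

Import Order.TTheory GRing.Theory Num.Theory numFieldNormedType.Exports.

Local Open Scope ring_scope.

(* A simple graph on a finite vertex type is given by its adjacency relation. *)
Definition is_clique (T : finType) (e : rel T) (S : {set T}) : bool :=
  [forall x in S, forall y in S, (x != y) ==> e x y].

Definition clique_number (T : finType) (e : rel T) : nat :=
  \max_(S : {set T} | is_clique e S) #|S|.

Definition cayley_sum_graph (V : finZmodType) (A : {set V}) : rel V :=
  fun x y => (x != y) && (x + y \in A).

(* Probability of the event E for the random subset of T that contains each
   element independently with probability p. *)
Definition random_subset_prob (R : realType) (T : finType) (p : R)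
    (E : pred {set T}) : R :=
  \sum_(A : {set T} | E A) \prod_(x : T) (if x \in A then p else 1 - p).

Definition log2 (R : realType) (x : R) : R := ln x / ln 2.

Definition omega (n : nat) (A : {set 'rV['F_2]_n}) : nat :=
  clique_number (cayley_sum_graph A).

Definition prob_omega_between (R : realType) (c C : R) (n : nat) : R :=
  random_subset_prob 2^-1 (fun A : {set 'rV['F_2]_n} =>
    (c * n%:R * log2 n%:R < (omega A)%:R) &&
    ((omega A)%:R < C * n%:R * log2 n%:R)).

(* Main.v *)
(* A clique of size [m] in the sum graph of [A] is a set [S] with [(S + S) \ 0] inside [A].

   Lower bound: the subspaces [{(x, xM)}], [M] a [k x d] matrix, have pairwise
   intersections governed by the rank of [M - M'], so the second moment method finds one
   whose nonzero elements lie in [A] as soon as [2 ^ k <= k * (d - k ^ 2)].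

   Upper bound: if [S] has slightly more than [2 ^ k] elements, where no subspace of size
   [2 ^ k.+1] fits in [A], we look for a subset of [S + S] of size [w] that can be
   described by fewer than [w] bits, and sum over descriptions. If [S] has large affine
   rank [r], a small generic subset [T] of [S] confines [S] to a set of polynomial size,
   and [S + E], for [E] a basis in [S], has about [r n] elements or more by a vertex
   isoperimetric inequality in the cube. If [r] is small, either many pairs of [S] have
   rare sums, and then two small subsets of [S] already have a large sumset, or nearly all
   pairs have sums in the set [P] of popular sums, which is covered by [T + T] with [T] of
   size [o(n)]. In the second case [|P|] exceeds [n r]: for [r] a large multiple of [k] by
   vertex isoperimetry, otherwise because bounded doubling forces [r <= k + O(1)]
   (Petridis, Ruzsa), while [|P| >= 2 ^ k.+1]: either two translates of [S] inside [P]
   are almost disjoint, or all sums of a large subset are popular and the Hopf-Stiefel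
   bound applies.

   Choosing [n] so that [n * k] is just below [2 ^ k.+1], or just above [2 ^ k], gives the
   two subsequences; sharpness of the constants follows since the windows are disjoint. *)

Require Import Defs.
From mathcomp Require Import all_boot all_order all_algebra.
From mathcomp Require Import all_fingroup all_solvable.
From mathcomp Require Import zify ring lra.
Import Order.TTheory GRing.Theory Num.Theory.

Set Implicit Arguments.
Unset Strict Implicit.
Unset Printing Implicit Defensive.

(** * Sumsets and Freiman's theorem for small doubling *)

Definition sumset (V : finZmodType) (A B : {set V}) : {set V} :=
  [set (a + b)%R | a in A, b in B].

Local Notation "A :+: B" := (sumset A B) (at level 45, left associativity).

Lemma mem_sumset (V : finZmodType) (A B : {set V}) a b :
  a \in A -> b \in B -> (a + b)%R \in A :+: B.
Proof. by move=> Aa Bb; apply/imset2P; exists a b. Qed.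

Lemma sumsetP (V : finZmodType) (A B : {set V}) x :
  reflect (exists a b, [/\ a \in A, b \in B & x = (a + b)%R]) (x \in A :+: B).
Proof.
apply: (iffP imset2P) => [[a b Aa Bb ->]|[a [b [Aa Bb ->]]]]; first by exists a, b.
by exists a b.
Qed.

Lemma sumsetC (V : finZmodType) (A B : {set V}) : A :+: B = B :+: A.
Proof.
by apply/setP=> x; apply/sumsetP/sumsetP => -[a [b [Aa Bb ->]]]; exists b, a; rewrite addrC.
Qed.

Lemma sumsetA (V : finZmodType) (A B C : {set V}) : A :+: (B :+: C) = A :+: B :+: C.
Proof.
apply/setP=> x; apply/sumsetP/sumsetP.
  case=> a [_ [Aa /sumsetP[b [c [Bb Cc ->]]] ->]].
  by exists (a + b)%R, c; rewrite addrA mem_sumset.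
case=> _ [c [/sumsetP[a [b [Aa Bb ->]]] Cc ->]].
by exists a, (b + c)%R; rewrite addrA mem_sumset.
Qed.

Lemma sumsetSS (V : finZmodType) (A A' B B' : {set V}) :
  A \subset A' -> B \subset B' -> A :+: B \subset A' :+: B'.
Proof.
move=> sA sB; apply/subsetP=> x /sumsetP[a [b [Aa Bb ->]]].
by rewrite mem_sumset // (subsetP sA, subsetP sB).
Qed.

Lemma sumset1E (V : finZmodType) (A : {set V}) x :
  [set x] :+: A = [set (x + a)%R | a in A].
Proof.
apply/setP=> y; apply/sumsetP/imsetP => [[_ [a [/set1P-> Aa ->]]]|[a Aa ->]].
  by exists a.
by exists x, a; rewrite set11.
Qed.

Lemma card_sumset1 (V : finZmodType) (A : {set V}) x : #|[set x] :+: A| = #|A|.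
Proof. by rewrite sumset1E card_imset //; apply: addrI. Qed.

Lemma mem_sumset1 (V : finZmodType) (A : {set V}) x y :
  (y \in [set x] :+: A) = ((y - x)%R \in A).
Proof.
rewrite sumset1E; apply/imsetP/idP => [[a Aa ->]|Ay].
  by rewrite addrC addKr.
by exists (y - x)%R => //; rewrite addrC subrK.
Qed.

Lemma leq_card_sumset (V : finZmodType) (A B : {set V}) x :
  x \in A -> #|B| <= #|A :+: B|.
Proof.
move=> Ax; rewrite -(card_sumset1 B x); apply/subset_leq_card/sumsetSS => //.
by rewrite sub1set.
Qed.

Lemma card_sumset_le (V : finZmodType) (A B : {set V}) : #|A :+: B| <= #|A| * #|B|.
Proof. by rewrite /sumset curry_imset2X -cardsX leq_imset_card. Qed.

Lemma sumset0l (V : finZmodType) (B : {set V}) : set0 :+: B = set0.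
Proof. by apply/setP=> x; rewrite inE; apply/sumsetP => -[a [b []]]; rewrite inE. Qed.

(** [X] minimises [#|Z :+: B| / #|Z|] over nonempty [Z]; with denominators cleared the inequality
    covers the empty [Z] too. *)
Lemma min_expansion (V : finZmodType) (A B : {set V}) : A != set0 ->
  exists X : {set V}, [/\ X \subset A, X != set0 &
    forall Z : {set V}, Z \subset A -> #|X :+: B| * #|Z| <= #|Z :+: B| * #|X|].
Proof.
move=> A0.
pose P := [pred Z : {set V} | (Z \subset A) && (Z != set0)].
pose M (Z : {set V}) := ((#|Z :+: B|%:R : rat) / #|Z|%:R)%R.
have PA : P A by rewrite inE subxx.
case: (Order.TotalTheory.arg_minP M PA) => X /andP[sXA X0] minX.
exists X; split=> // Z sZA.
have [->|Z0] := eqVneq Z set0; first by rewrite cards0 muln0.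
have := minX Z; rewrite inE sZA Z0 => /(_ isT).
have pos (T : {set V}) : T != set0 -> (0 < (#|T|%:R : rat))%R.
  by rewrite -card_gt0 ltr0n.
rewrite /M ler_pdivrMr ?pos // mulrAC ler_pdivlMr ?pos //.
by rewrite -!natrM ler_nat.
Qed.

(* Petridis' argument: adding one translate [c + X] to [C + X] gains at least
   as many points, relative to the expansion ratio, as it gains in [C + X + B]. *)
Lemma petridis (V : finZmodType) (X B C : {set V}) :
  (forall Z : {set V}, Z \subset X -> #|X :+: B| * #|Z| <= #|Z :+: B| * #|X|) ->
  #|C :+: (X :+: B)| * #|X| <= #|X :+: B| * #|C :+: X|.
Proof.
move=> minX; move: {2}#|C| (erefl #|C|) => n.
elim: n C => [|n IH] C.
  by move/eqP; rewrite cards_eq0 => /eqP ->; rewrite sumset0l cards0.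
move=> Cn; have /set0Pn[c Cc] : C != set0 by rewrite -card_gt0 Cn.
have {}IH := IH (C :\ c); rewrite -(setD1K Cc).
have C'n : #|C :\ c| = n by move: Cn; rewrite (cardsD1 c) Cc => -[].
have {IH} := IH C'n.
set C' := C :\ c => IH.
(* These points bring nothing new to [C' :+: X], and [[set c] :+: (Z :+: B)] is old as well. So [c]
   adds at most [#|X :+: B| - #|Z :+: B|] sums on one side ([h1]) and at least [#|X| - #|Z|] on the
   other ([h2]). *)
pose Z := [set x in X | (c + x)%R \in C' :+: X].
have sZX : Z \subset X by apply/subsetP=> x; rewrite inE => /andP[].
have h1 : #|(c |: C') :+: (X :+: B)| + #|Z :+: B| <= #|C' :+: (X :+: B)| + #|X :+: B|.
  rewrite -(card_sumset1 (X :+: B) c) -(card_sumset1 (Z :+: B) c).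
  have sZ : [set c] :+: (Z :+: B) \subset [set c] :+: (X :+: B) :&: (C' :+: (X :+: B)).
    rewrite subsetI; apply/andP; split; first by rewrite !sumsetSS.
    apply/subsetP=> y /sumsetP[_ [_ [/set1P-> /sumsetP[z [b [+ Bb ->]]] ->]]].
    rewrite inE => /andP[Xz /sumsetP[c' [x [C'c' Xx e]]]].
    by rewrite addrA e -addrA !mem_sumset.
  have sU : (c |: C') :+: (X :+: B) \subset
      (C' :+: (X :+: B)) :|: ([set c] :+: (X :+: B)).
    apply/subsetP=> y /sumsetP[d [w [+ Ww ->]]].
    rewrite in_setU1 in_setU => /orP[/eqP->|Cd]; apply/orP; [right|left].
      by rewrite mem_sumset ?set11.
    by rewrite mem_sumset.
  have := subset_leq_card sU; have := subset_leq_card sZ.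
  rewrite cardsU setIC; set I := _ :&: _.
  have : #|I| <= #|[set c] :+: (X :+: B)| by apply/subset_leq_card/subsetIr.
  by lia.
have h2 : #|C' :+: X| + #|X| <= #|(c |: C') :+: X| + #|Z|.
  rewrite -(card_sumset1 X c) -(card_sumset1 Z c).
  have sI : (C' :+: X) :&: ([set c] :+: X) \subset [set c] :+: Z.
    apply/subsetP=> y /setIP[Cy /sumsetP[_ [x [/set1P-> Xx e]]]].
    by rewrite e mem_sumset ?set11 // inE Xx -e.
  have sU : (C' :+: X) :|: ([set c] :+: X) \subset (c |: C') :+: X.
    by rewrite subUset !sumsetSS ?subsetUr ?subsetUl.
  have := subset_leq_card sU; have := subset_leq_card sI.
  rewrite cardsU; set I := _ :&: _.
  have : #|I| <= #|C' :+: X| by apply/subset_leq_card/subsetIl.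
  by lia.
have h3 := minX Z sZX.
have e1 : (#|(c |: C') :+: (X :+: B)| + #|Z :+: B|) * #|X| <=
          (#|C' :+: (X :+: B)| + #|X :+: B|) * #|X| by rewrite leq_mul2r h1 orbT.
have e2 : #|X :+: B| * (#|C' :+: X| + #|X|) <= #|X :+: B| * (#|(c |: C') :+: X| + #|Z|).
  by rewrite leq_mul2l h2 orbT.
move: e1 e2; rewrite !mulnDl !mulnDr; lia.
Qed.

(* Ruzsa covering: a maximal family of disjoint translates of a Petridis set [X] by
   elements [Y] of [3B] has at most [kappa ^ 3] members, and [3B] lies in [Y + 2B]. *)
Lemma small_doubling_closure (V : finZmodType) (B : {set V}) (kappa : nat) :
  (forall x : V, x + x = 0)%R -> 0%R \in B -> #|B :+: B| <= kappa * #|B| ->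
  exists G : {set V}, [/\ 0%R \in G, G :+: B \subset G &
     #|G| <= 2 ^ (kappa ^ 3) * (kappa * #|B|)].
Proof.
move=> char2 B0 dbl.
have Bn0 : B != set0 by apply/set0Pn; exists 0%R.
have Bpos : 0 < #|B| by rewrite card_gt0.
have [X [sXB X0 minX]] := min_expansion B Bn0.
have Xpos : 0 < #|X| by rewrite card_gt0.
have k1 : #|X :+: B| <= kappa * #|X|.
  rewrite -(leq_pmul2r Bpos) (leq_trans (minX _ (subxx B))) //.
  by rewrite mulnAC leq_mul2r dbl orbT.
have minX' (Z : {set V}) : Z \subset X -> #|X :+: B| * #|Z| <= #|Z :+: B| * #|X|.
  by move=> sZ; apply/minX/(subset_trans sZ).
have pet C : #|C :+: (X :+: B)| <= kappa * #|C :+: X|.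
  rewrite -(leq_pmul2r Xpos) (leq_trans (petridis C minX')) //.
  by rewrite mulnAC leq_mul2r k1 orbT.
have k3 : #|B :+: (B :+: B) :+: X| <= kappa ^ 3 * #|X|.
  have e : B :+: (B :+: B) :+: X = (B :+: B) :+: (X :+: B).
    by rewrite (sumsetC X B) !sumsetA.
  rewrite e; apply: leq_trans (pet _) _.
  rewrite expnS -mulnA leq_mul2l; apply/orP; right.
  rewrite -sumsetA (sumsetC B X); apply: leq_trans (pet _) _.
  rewrite expnS -mulnA leq_mul2l; apply/orP; right.
  by rewrite expn1 sumsetC.
pose indep (Y : {set V}) := [forall y in Y, forall y' in Y, forall x in X, forall x' in X,
   (y + x == y' + x')%R ==> (y == y')].
have indepP (Y : {set V}) : reflect (forall y y' x x', y \in Y -> y' \in Y -> x \in X ->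
    x' \in X -> (y + x = y' + x')%R -> y = y') (indep Y).
  apply: (iffP forall_inP) => [h y y' x x' Yy Yy' Xx Xx' /eqP e|h y Yy].
    have /forall_inP/(_ y' Yy')/forall_inP/(_ x Xx)/forall_inP/(_ x' Xx') := h y Yy.
    by rewrite e => /eqP.
  apply/forall_inP=> y' Yy'; apply/forall_inP=> x Xx; apply/forall_inP=> x' Xx'.
  by apply/implyP=> /eqP e; apply/eqP/(h y y' x x').
pose P (Y : {set V}) := (Y \subset B :+: (B :+: B)) && indep Y.
have P0 : P set0 by rewrite /P sub0set; apply/indepP=> y y' x x'; rewrite inE.
case: (arg_maxnP (fun Y : {set V} => #|Y|) P0) => Y /andP[sY /indepP indY] maxY.
have cardY : #|Y| <= kappa ^ 3.
  rewrite -(leq_pmul2r Xpos); apply: leq_trans k3.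
  rewrite -cardsX -(@card_in_imset _ _ (fun p : V * V => (p.1 + p.2)%R)).
    apply/subset_leq_card/subsetP=> z /imsetP[[y x] /setXP[/= Yy Xx] ->].
    by rewrite mem_sumset // (subsetP sY).
  case=> [y x] [y' x'] /setXP[/= Yy Xx] /setXP[/= Yy' Xx'] e.
  have ey := indY _ _ _ _ Yy Yy' Xx Xx' e; move: e; rewrite ey => /addrI ->.
  by [].
have cover z : z \in B :+: (B :+: B) -> exists2 y, y \in Y & (z + y)%R \in B :+: B.
  move=> Bz; have [Yz|Yz] := boolP (z \in Y).
    by exists z => //; rewrite char2 -(addr0 0%R) mem_sumset.
  have : ~~ P (z |: Y).
    by apply/negP=> /maxY /=; rewrite cardsU1 Yz ltnn.
  rewrite /P subUset sub1set Bz sY /= => nind.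
  have [/existsP[y /existsP[x /existsP[x' /and4P[Yy Xx Xx' /eqP e]]]]|nex] :=
    boolP [exists y, exists x, exists x', [&& y \in Y, x \in X, x' \in X &
       (z + x == y + x')%R]].
    exists y => //; have -> : (z + y = x' + x)%R.
      by apply: (@addIr _ x); rewrite addrAC e addrAC char2 add0r -addrA char2 addr0.
    by rewrite mem_sumset // (subsetP sXB).
  case/negP: nind; apply/indepP=> y y' x x'.
  have no u v w : u \in Y -> v \in X -> w \in X -> (z + v = u + w)%R -> False.
    move=> Yu Xv Xw e; case/negP: nex; apply/existsP; exists u; apply/existsP; exists v.
    by apply/existsP; exists w; rewrite Yu Xv Xw e eqxx.
  rewrite !inE => /orP[/eqP->|Yy] /orP[/eqP->|Yy'] Xx Xx' e //.
  - by case: (no _ _ _ Yy' Xx Xx' e).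
  - by case: (no _ _ _ Yy Xx' Xx (esym e)).
  - exact: indY e.
(* By [y + y = 0] the subset sums of [Y] are all of its span. Adding [b] to [w] gives an element of
   [B :+: (B :+: B)]; [cover] brings it back into [B :+: B] at the price of toggling one [y] in
   [J]. *)
pose G := [set ((\sum_(y in (J : {set V})) y) + w)%R | J in powerset Y, w in B :+: B].
exists G; split.
- apply/imset2P; exists set0 0%R; rewrite ?big_set0 ?addr0 ?inE ?sub0set //.
  by rewrite -(addr0 0%R) mem_sumset.
- apply/subsetP=> _ /sumsetP[_ [b [/imset2P[J w + Ww ->] Bb ->]]].
  rewrite inE => sJ.
  have [|y Yy Wy] := cover (b + w)%R; first by rewrite mem_sumset.
  have [Jy|Jy] := boolP (y \in J).
    apply/imset2P; exists (J :\ y) (b + w + y)%R => //.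
      by rewrite inE (subset_trans _ sJ) ?subD1set.
    rewrite (big_setD1 y Jy) /=.
    by rewrite [(y + _)%R]addrC -!addrA; congr (_ + _)%R; rewrite addrC (addrC w) -addrA.
  apply/imset2P; exists (y |: J) (b + w + y)%R => //.
    by rewrite inE subUset sub1set Yy.
  rewrite big_setU1 //=.
  by rewrite -[RHS]addrA [RHS]addrC -!addrA char2 addr0 (addrC w).
- rewrite /G curry_imset2X (leq_trans (leq_imset_card _ _)) //.
  rewrite cardsX card_powerset leq_mul // leq_exp2l //.
Qed.

(** * The Hopf-Stiefel bound and vertex expansion in the cube *)

Lemma card_group_char2 (V : finZmodType) (H : {group V}) :
  (forall x : V, x + x = 0)%R -> exists e, #|H| = 2 ^ e.
Proof.
move=> char2; suff /p_natP[e ->] : 2.-nat #|H| by exists e.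
rewrite -/(pgroup 2 H) -pnat_exponent.
apply: (@pnat_dvd _ 2) => //.
by apply/exponentP=> x _; rewrite expgS expg1 FinRing.zmodMgE char2.
Qed.

(** [A] is a union of cosets of [H], removed one at a time. *)
Lemma dvdn_card_stable (V : finZmodType) (H : {group V}) (A : {set V}) :
  (forall a h, a \in A -> h \in H -> (a + h)%R \in A) -> #|H| %| #|A|.
Proof.
move: {2}#|A| (leqnn #|A|) => n.
elim: n A => [|n IH] A; first by rewrite leqn0 => /eqP ->; rewrite dvdn0.
have [->|/set0Pn[a Aa]] := eqVneq A set0; first by rewrite cards0 dvdn0.
move=> An stab; pose C := [set a] :+: (H : {set V}).
have sCA : C \subset A.
  by apply/subsetP=> x /sumsetP[_ [h [/set1P-> Hh ->]]]; apply: stab.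
have cC : #|C| = #|H| by rewrite card_sumset1.
have cA : #|A| = #|C| + #|A :\: C| by rewrite -(cardsID C A) (setIidPr sCA).
rewrite cA cC dvdn_addr //; apply: IH.
  have : 0 < #|H| by apply: cardG_gt0.
  by lia.
move=> x h /setDP[Ax Cx] Hh; rewrite inE stab // andbT.
apply: contra Cx; rewrite !mem_sumset1 => Hx.
have -> : (x - a = x + h - a - h)%R by rewrite [(x + h - a)%R]addrAC addrK.
by rewrite -[(_ - h)%R]/(_ * h^-1)%g groupM ?groupV.
Qed.

(* Dyson's e-transform reduces to the case where [A] is stable under translation by
   [B + B]; then [A] is a union of cosets of a subgroup with at least [#|B|] elements,
   whose order is a power of 2. *)
Lemma sumset_power2 (V : finZmodType) (A B : {set V}) k :
  (forall x : V, x + x = 0)%R -> A != set0 -> B != set0 ->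
  2 ^ k < #|A| + #|B| -> 2 ^ k <= #|A :+: B|.
Proof.
move=> char2; move: {2}#|B| (leqnn #|B|) => n.
elim: n A B => [|n IH] A B.
  by rewrite leqn0 cards_eq0 => /eqP-> _; rewrite eqxx.
move=> Bn A0 B0 lt.
have cancel2 (x y : V) : (x + y + y = x)%R by rewrite -addrA char2 addr0.
have [stab|] := boolP [forall a in A, forall b in B, forall b' in B, (a + b + b')%R \in A].
  have {}stab a b b' : a \in A -> b \in B -> b' \in B -> (a + b + b')%R \in A.
    by move=> Aa Bb Bb'; move/forall_inP/(_ a Aa)/forall_inP/(_ b Bb)/forall_inP: stab => ->.
  pose H := [set h | [set h] :+: A == A].
  have HP h : reflect (forall a, a \in A -> (a + h)%R \in A) (h \in H).
    rewrite inE; apply: (iffP eqP) => [e a Aa|h1].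
      by rewrite -e addrC mem_sumset ?set11.
    apply/eqP; rewrite eqEcard card_sumset1 leqnn andbT.
    by apply/subsetP=> x /sumsetP[_ [a [/set1P-> Aa ->]]]; rewrite addrC h1.
  have gH : group_set H.
    apply/group_setP; split; first by apply/HP=> a Aa; rewrite addr0.
    move=> x y /HP Hx /HP Hy; apply/HP=> a Aa.
    by rewrite FinRing.zmodMgE addrA Hy // Hx.
  pose HG := Group gH.
  have [e He] := card_group_char2 HG char2.
  have dvd : #|HG| %| #|A|.
    by apply: dvdn_card_stable => a h Aa /HP; apply.
  have [b0 Bb0] := set0Pn _ B0.
  have BH : #|B| <= #|HG|.
    rewrite -(card_sumset1 B b0); apply/subset_leq_card/subsetP => x.
    case/sumsetP=> _ [b [/set1P-> Bb ->]].
    by apply/HP=> a Aa; rewrite addrA stab.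
  have [a0 Aa0] := set0Pn _ A0.
  apply: leq_trans (_ : #|A| <= _); last by rewrite sumsetC (leq_card_sumset _ Bb0).
  have Apos : 0 < #|A| by rewrite card_gt0.
  have [ke|ek] := leqP k e.
    apply: leq_trans (dvdn_leq Apos dvd); rewrite He leq_exp2l //.
  (* Both [#|A|] and [2 ^ k] are now multiples of [#|HG|], which is at least [#|B|], so
     [2 ^ k < #|A| + #|B|] forces [2 ^ k <= #|A|]. *)
  have dk : #|HG| %| 2 ^ k by rewrite He dvdn_exp2l // ltnW.
  move: lt dvd dk BH; set h := #|HG| => lt /dvdnP[x ex] /dvdnP[y ey].
  move: lt; rewrite ex ey => lt BH.
  have hpos : 0 < h by rewrite /h He expn_gt0.
  rewrite leq_pmul2r //.
  have : y * h < (x + 1) * h by rewrite mulnDl mul1n; move: lt BH; clear; lia.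
  by rewrite ltn_pmul2r // addn1 ltnS.
rewrite negb_forall_in => /exists_inP[a Aa]; rewrite negb_forall_in => /exists_inP[b Bb].
rewrite negb_forall_in => /exists_inP[b' Bb' nA].
(* Dyson's transform: [#|A'| + #|B'|] equals [#|A| + #|B|], [A' :+: B'] lies in [A :+: B], and [B']
   keeps [b] but loses [b'], so the induction advances. *)
pose e := (a + b)%R; pose A' := A :|: ([set e] :+: B); pose B' := B :&: ([set e] :+: A).
have opp (x : V) : (- x = x)%R by apply/eqP; rewrite eq_sym -addr_eq0 char2.
have Bb1 : b \in B' by rewrite !inE Bb mem_sumset1 opp /e addrC cancel2.
have sB : #|B'| < #|B|.
  apply/proper_card/properP; split; first exact: subsetIl.
  by exists b' => //; rewrite !inE Bb' mem_sumset1 opp /= addrC /e.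
have sumAB : #|A'| + #|B'| = #|A| + #|B|.
  have -> : #|B'| = #|A :&: ([set e] :+: B)|.
    rewrite -(card_sumset1 B' e); congr #|pred_of_set _|; apply/setP=> x.
    by rewrite !inE !mem_sumset1 !inE !mem_sumset1 !opp cancel2 andbC.
  rewrite cardsU card_sumset1.
  have : #|A :&: ([set e] :+: B)| <= #|A| by apply/subset_leq_card/subsetIl.
  by lia.
apply: leq_trans (_ : #|A' :+: B'| <= _).
  apply: IH; rewrite ?sumAB //; first by rewrite -ltnS (leq_trans sB).
    by apply/set0Pn; exists a; rewrite inE Aa.
  by apply/set0Pn; exists b.
apply/subset_leq_card/subsetP=> _ /sumsetP[x [y [+ + ->]]].
rewrite !inE => Ax /andP[By]; rewrite !mem_sumset1 !opp => Ay.
case/orP: Ax => [Ax|]; first by rewrite mem_sumset.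
rewrite mem_sumset1 opp => Bx.
have -> : (x + y = (y + e) + (x + e))%R by rewrite [RHS]addrACA char2 addr0 addrC.
by rewrite mem_sumset.
Qed.

Local Open Scope ring_scope.

Definition support r (x : 'rV['F_2]_r) : {set 'I_r} := [set i | x 0 i != 0].
Definition weight r (x : 'rV['F_2]_r) : nat := #|support x|.
Definition unit_vectors r : {set 'rV['F_2]_r} := [set delta_mx 0 i | i : 'I_r].

Lemma F2_char2 (x : 'F_2) : x + x = 0.
Proof. by apply/val_inj; case: x => [[|[|]]]. Qed.

Lemma mx_char2 m n (x : 'M['F_2]_(m, n)) : x + x = 0.
Proof. by apply/matrixP=> i j; rewrite !mxE F2_char2. Qed.

Lemma supportD1 r (x : 'rV['F_2]_r) i j :
  (j \in support (x + delta_mx 0 i)) = (j \in support x) (+) (j == i).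
Proof.
rewrite !inE !mxE eqxx /=; case: (j == i); last by rewrite addr0 addbF.
by move: (x 0 j) => [[|[|]]].
Qed.

Lemma weight_up r (x : 'rV['F_2]_r) i :
  i \notin support x -> weight (x + delta_mx 0 i) = (weight x).+1.
Proof.
move=> xi; rewrite /weight.
have -> : support (x + delta_mx 0 i) = i |: support x.
  apply/setP=> j; rewrite supportD1 in_setU1.
  by have [->|_] := eqVneq j i; rewrite ?(negbTE xi) ?addbF.
by rewrite cardsU1 xi.
Qed.

Definition cube_degree r (Y : {set 'rV['F_2]_r}) x : nat :=
  #|[set i : 'I_r | x + delta_mx 0 i \in Y]|.

(** Both sides count the cube edges from [X] to [Y], since translation by a unit vector is an
    involution. *)
Lemma cube_degree_exchange r (X Y : {set 'rV['F_2]_r}) :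
  (\sum_(x in X) cube_degree Y x = \sum_(y in Y) cube_degree X y)%N.
Proof.
have E (A B : {set 'rV['F_2]_r}) : (\sum_(x in A) cube_degree B x =
   \sum_(i < r) \sum_x ((x \in A) && ((x + delta_mx 0 i)%R \in B)))%N.
  rewrite exchange_big /= big_mkcond /=; apply: eq_bigr => x _.
  case: (x \in A) => /=; last by rewrite big1.
  by rewrite /cube_degree -sum1dep_card big_mkcond; apply: eq_bigr => i _; case: ifP.
rewrite !E; apply: eq_bigr => i _.
have inv : involutive (fun x : 'rV['F_2]_r => x + delta_mx 0 i).
  by move=> x; rewrite -addrA mx_char2 addr0.
rewrite (reindex_inj (inv_inj inv)) /=; apply: eq_bigr => x _.
by rewrite inv andbC.
Qed.

(** Count the edges going up one layer. A point at distance [w] from [x0] has at most [w] downward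
    neighbours, hence at least [D - w] upward ones in [Y]; a point at distance [w.+1] has at most
    [w.+1] downward ones. *)
Lemma layer_growth r (X Y : {set 'rV['F_2]_r}) x0 w D :
  (forall x, x \in X -> D <= cube_degree Y x)%N ->
  ((D - w) * #|[set x in X | weight (x + x0)%R == w]| <=
     w.+1 * #|[set y in Y | weight (y + x0)%R == w.+1]|)%N.
Proof.
move=> degX; set A := [set x in X | _]; set B := [set y in Y | _].
rewrite mulnC -sum_nat_const [leqRHS]mulnC -sum_nat_const.
apply: (@leq_trans (\sum_(x in A) cube_degree B x)%N).
  apply: leq_sum => x; rewrite inE => /andP[Xx /eqP wx].
  rewrite leq_subLR (leq_trans (degX x Xx)) // /cube_degree -{1}wx /weight -cardsUI.
  apply: leq_trans (leq_addr _ _); apply/subset_leq_card/subsetP=> i.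
  rewrite in_set in_setU => Yi; have [//|nsupp] /= := boolP (i \in support (x + x0)).
  by rewrite in_set in_set Yi addrAC weight_up ?wx ?eqxx.
rewrite cube_degree_exchange; apply: leq_sum => y; rewrite inE => /andP[Yy /eqP wy].
rewrite -wy /weight; apply/subset_leq_card/subsetP=> i.
rewrite in_set in_set => /andP[_ wi]; apply: contraT => nsupp.
by move: wi; rewrite addrAC weight_up // wy => /eqP; lia.
Qed.

(* If [S] had few neighbours, a subgraph of the cube between [S] and its neighbours would
   have large minimum degrees on both sides (maximise a weighted edge count), and then the
   layers around any of its vertices would grow too fast to fit in [S]. *)
Lemma vertex_expansion r l (S : {set 'rV['F_2]_r}) :
  (16 * l <= r)%N -> (#|S| * (16 * l) ^ l < r ^ l)%N ->
  (#|S| * r <= 8 * l * #|S :+: unit_vectors r|)%N.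
Proof.
move=> lr small; rewrite leqNgt; apply/negP => few.
set N := S :+: unit_vectors r in few.
pose e (X Y : {set 'rV['F_2]_r}) := (\sum_(x in X) cube_degree Y x)%N.
(* The coefficients make [f (S, N)] positive under [few], which keeps the maximiser's [X] nonempty.
   Deleting one point then shows degrees at least [r / 4] from [X] to [Y] and [4 * l] from [Y] to
   [X]. *)
pose f (p : {set 'rV['F_2]_r} * {set 'rV['F_2]_r}) : int :=
  (4 * e p.1 p.2)%:Z - (r * #|p.1|)%:Z - (16 * l * #|p.2|)%:Z.
pose P (p : {set 'rV['F_2]_r} * {set 'rV['F_2]_r}) := (p.1 \subset S).
have P0 : P (S, N) by rewrite /P /=.
case: (arg_maxP f P0) => -[X Y]; rewrite /P /= => sXS maxXY.
have fpos : 0 < f (X, Y).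
  apply: lt_le_trans (maxXY _ P0).
  have : e S N = (#|S| * r)%N.
    rewrite /e -sum_nat_const; apply: eq_bigr => x Sx.
    rewrite /cube_degree -[RHS]card_ord -cardsT; congr #|pred_of_set _|.
    by apply/setP=> i; rewrite !inE mem_sumset //; apply: imset_f.
  rewrite /f /= => ->; move: few; move: #|S| #|N| => a b.
  by rewrite -[(8 * l * b)%N]mulnA -[(16 * l * b)%N]mulnA; lia.
have degX x : x \in X -> (r <= 4 * cube_degree Y x)%N.
  move=> Xx; have := maxXY (X :\ x, Y); rewrite /P /= (subset_trans (subD1set _ _)) //.
  move=> /(_ isT); rewrite /f /= /e (big_setD1 x Xx) /= (cardsD1 x X) Xx.
  move: (\sum_(_ in _) _)%N #|X :\ x| (16 * l * #|Y|)%N (cube_degree Y x) => a b c d.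
  by rewrite add1n mulnS mulnDr; lia.
have degY y : y \in Y -> (4 * l <= cube_degree X y)%N.
  move=> Yy; have := maxXY (X, Y :\ y); rewrite /P /= sXS => /(_ isT).
  rewrite /f /= /e (cube_degree_exchange X Y) (cube_degree_exchange X (Y :\ y)) (big_setD1 y Yy) /= (cardsD1 y Y) Yy.
  move: (\sum_(_ in _) _)%N #|Y :\ y| (r * #|X|)%N (cube_degree X y) => a b c d.
  by rewrite add1n mulnS mulnDr; lia.
have [X0|/set0Pn[x0 Xx0]] := eqVneq X set0.
  by move: fpos; rewrite /f /e /= X0 big_set0 cards0; lia.
pose L j := [set x in X | weight (x + x0) == j.*2].
pose M j := [set y in Y | weight (y + x0) == j.*2.+1].
(* Two layers at a time. Below distance [2 * l] downward edges use at most half of each degree, so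
   going from [L j] to [M j] gains a factor [r / (16 * l)] and going from [M j] to [L j.+1] loses
   nothing. *)
have step j : (j < l)%N -> (r * #|L j| <= 16 * l * #|L j.+1|)%N.
  move=> jl.
  have h1 : (r * #|L j| <= 16 * l * #|M j|)%N.
    have degX' x : x \in X -> ((r + 3) %/ 4 <= cube_degree Y x)%N.
      by move/degX => h; lia.
    have := layer_growth x0 j.*2 degX'; rewrite -/(L j) -/(M j) => h.
    have a1 : (r <= 8 * ((r + 3) %/ 4 - j.*2))%N by lia.
    have a2 : (j.*2.+1 <= 2 * l)%N by lia.
    apply: (@leq_trans (8 * ((r + 3) %/ 4 - j.*2) * #|L j|)); first by rewrite leq_mul2r a1 orbT.
    rewrite -mulnA (leq_trans (leq_mul (leqnn 8) h)) // mulnA leq_mul2r; lia.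
  have := layer_growth x0 j.*2.+1 degY; rewrite -doubleS -/(L j.+1) -/(M j) => h.
  have a1 : (2 * l <= 4 * l - j.*2.+1)%N by lia.
  have a2 : (j.+1.*2 <= 2 * l)%N by lia.
  have h2 : (2 * l * #|M j| <= 2 * l * #|L j.+1|)%N.
    by apply: leq_trans (leq_trans h _); rewrite leq_mul2r ?a1 ?a2 orbT.
  apply: leq_trans h1 _; rewrite leq_mul2l; apply/orP; right.
  by move: h2; rewrite leq_mul2l; case/orP => //; lia.
have grow j : (j <= l)%N -> (r ^ j <= (16 * l) ^ j * #|L j|)%N.
  elim: j => [_|j IH jl].
    rewrite !expn0 mul1n card_gt0; apply/set0Pn; exists x0; rewrite inE Xx0 mx_char2 /=.
    by rewrite /weight cards_eq0; apply/eqP/setP=> i; rewrite !inE mxE eqxx.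
  rewrite !expnS; apply: (@leq_trans (r * ((16 * l) ^ j * #|L j|))%N).
    by rewrite leq_mul2l IH ?orbT // ltnW.
  by rewrite mulnCA [(_ * (16 * l) ^ j)%N]mulnC -[leqRHS]mulnA leq_mul2l step ?orbT.
have := grow l (leqnn l); rewrite leqNgt => /negP; apply.
apply: leq_ltn_trans small; rewrite mulnC leq_mul2r; apply/orP; right.
by apply/subset_leq_card/(subset_trans _ sXS)/subsetP=> x; rewrite inE => /andP[].
Qed.

Local Close Scope ring_scope.

(** * Popular sums *)

Lemma leq_card_bigcup (T I : finType) (Y : {set I}) (F : I -> {set T}) :
  #|\bigcup_(y in Y) F y| <= \sum_(y in Y) #|F y|.
Proof.
apply: (big_ind2 (fun (A : {set T}) n => #|A| <= n)) => [|A a B b hA hB|//].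
  by rewrite cards0.
by rewrite cardsU; lia.
Qed.

Lemma bernoulli_nat a c u : a ^ u.+1 + u.+1 * c * a ^ u <= (a + c) ^ u.+1.
Proof.
elim: u => [|u IH]; first by rewrite !expn1 expn0 mul1n muln1.
rewrite [leqRHS]expnS; apply: leq_trans (leq_mul (leqnn (a + c)) IH).
rewrite !expnS mulnDl !mulnDr; lia.
Qed.

(** Bernoulli's inequality: [u] independent points of an [m]-set miss a given [c]-subset with
    probability at most one half. *)
Lemma half_power m c u : 0 < c -> c <= m -> m <= u * c -> 2 * (m - c) ^ u <= m ^ u.
Proof.
move=> c0 cm mu; have u0 : 0 < u by move: mu; case: u => //; lia.
rewrite -{2}(subnK cm); case: u u0 mu => // u _ mu.
apply: leq_trans (bernoulli_nat _ _ _); rewrite mul2n -addnn leq_add2l expnS leq_mul2r.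
by apply/orP; right; apply: leq_trans mu; apply: leq_subr.
Qed.

(* Count the [p * u]-tuples of elements of [S] that miss some [F y]. *)
Lemma hitting_set (T I : finType) (S : {set T}) (Y : {set I}) (F : I -> {set T}) c p u :
  0 < c -> #|S| <= u * c -> #|Y| < 2 ^ p ->
  (forall y, y \in Y -> F y \subset S) -> (forall y, y \in Y -> c <= #|F y|) ->
  exists X : {set T}, [/\ X \subset S, #|X| <= p * u &
    forall y, y \in Y -> X :&: F y != set0].
Proof.
move=> c0 Su Yp FS Fc.
have [->|/set0Pn[y0 Yy0]] := eqVneq Y set0.
  by exists set0; split=> [||y]; rewrite ?sub0set ?cards0 ?inE.
have cS : c <= #|S| by apply: leq_trans (Fc _ Yy0) (subset_leq_card (FS _ Yy0)).
set x := p * u.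
have [/existsP[f /andP[fS hit]]|no] :=
  boolP [exists f : {ffun 'I_x -> T}, (f \in ffun_on S) &&
     [forall y in Y, [exists i, f i \in F y]]].
  exists [set f i | i : 'I_x]; split.
  - by apply/subsetP=> _ /imsetP[i _ ->]; move/ffun_onP: fS.
  - by apply: (@leq_trans #|'I_x|); [exact: leq_imset_card|rewrite card_ord].
  - move=> y Yy; move/forall_inP/(_ y Yy)/existsP: hit => [i Fi].
    by apply/set0Pn; exists (f i); rewrite inE Fi imset_f.
exfalso; suff : #|S| ^ x <= #|Y| * (#|S| - c) ^ x.
  have h := half_power c0 cS Su.
  have h2 : 2 ^ p * (#|S| - c) ^ x <= #|S| ^ x.
    rewrite /x [p * u]mulnC !expnM -expnMn leq_exp2r //.
    have: 0 < 2 ^ p by rewrite expn_gt0.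
    by case: p Yp {x no h} => // /[!expn0]; rewrite ltnS leqn0 cards_eq0 => /eqP Y0;
      rewrite Y0 inE in Yy0.
  move=> h3; have := leq_trans h2 h3.
  have [a0|pos] := posnP ((#|S| - c) ^ x); last by rewrite leq_pmul2r // leqNgt Yp.
  by move: h3; rewrite a0 muln0 leqn0 expn_eq0 => /andP[/eqP S0 _]; move: cS; rewrite S0; lia.
rewrite -[x in leqLHS]card_ord -(card_ffun_on 'I_x (mem S)).
apply: (@leq_trans #|\bigcup_(y in Y) [set f : {ffun 'I_x -> T} | f \in ffun_on (S :\: F y)]|).
  apply/subset_leq_card/subsetP=> f fS.
  move/existsPn: no => /(_ f); rewrite fS /= negb_forall_in => /exists_inP[y Yy].
  rewrite negb_exists => /forallP nF.
  apply/bigcupP; exists y => //; rewrite inE; apply/ffun_onP=> i.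
  by rewrite inE nF; move/ffun_onP: fS; apply.
apply: leq_trans (leq_card_bigcup _ _) _.
rewrite -sum_nat_const; apply: leq_sum => y Yy.
have -> : #|[set f : {ffun 'I_x -> T} | f \in ffun_on (S :\: F y)]| = #|S :\: F y| ^ x.
  by rewrite cardsE card_ffun_on card_ord.
have e := cardsID (F y) S; rewrite (setIidPr (FS y Yy)) in e.
by case: (posnP x) => [->//|x0]; rewrite leq_exp2r //; move: (Fc y Yy); lia.
Qed.

Definition rep_set (V : finZmodType) (S : {set V}) (y : V) : {set V} :=
  [set s in S | (s + y)%R \in S].

(** Two rounds of hitting sets. The first builds [T1] meeting each [rep_set S y] in at least [j]
    points, so at least [j] elements [s] of [S] have [s + y] in [T1]; the second hits these with
    [X], and [y] is the sum of [s] and [s + y]. *)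
Lemma popular_cover (V : finZmodType) (S P : {set V}) c j p u1 u2 :
  (forall x : V, x + x = 0)%R -> 0 < c -> 0 < j -> #|P| < 2 ^ p ->
  (forall y, y \in P -> 2 * c <= #|rep_set S y|) ->
  j * (p * u1) <= c -> #|S| <= u1 * c -> #|S| <= u2 * j ->
  exists T : {set V}, [/\ T \subset S, #|T| <= j * (p * u1) + p * u2 & P \subset T :+: T].
Proof.
move=> char2 c0 j0 Pp rep jc Sc Sj.
have cancel2 (x y : V) : (x + y + y = x)%R by rewrite -addrA char2 addr0.
have repS y : rep_set S y \subset S by apply/subsetP=> s; rewrite inE => /andP[].
have [T1 [sT1 cT1 hit1]] : exists T1 : {set V}, [/\ T1 \subset S, #|T1| <= j * (p * u1) &
    forall y, y \in P -> j <= #|T1 :&: rep_set S y|].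
  suff: forall i, i <= j -> exists T1 : {set V}, [/\ T1 \subset S, #|T1| <= i * (p * u1) &
    forall y, y \in P -> i <= #|T1 :&: rep_set S y|] by apply.
  elim=> [_|i IH ij]; first by exists set0; split=> //; rewrite ?sub0set ?cards0.
  have [T1 [sT1 cT1 hit1]] := IH (ltnW ij).
  have [y Py|y Py|X [sX cX hit]] :=
    @hitting_set V V S P (fun y => rep_set S y :\: T1) c p u1 c0 Sc Pp.
  - by apply: subset_trans (subsetDl _ _) (repS y).
  - have e := cardsID T1 (rep_set S y); have := rep y Py.
    have : #|rep_set S y :&: T1| <= #|T1| by apply/subset_leq_card/subsetIr.
    have : i * (p * u1) <= j * (p * u1) by rewrite leq_mul2r (ltnW ij) orbT.
    by lia.
  exists (T1 :|: X); split=> [||y Py]; first by rewrite subUset sT1 sX.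
    by rewrite cardsU mulSn; lia.
  have /set0Pn[s /setIP[Xs /setDP[Rs T1s]]] := hit y Py.
  apply: leq_trans (_ : #|s |: (T1 :&: rep_set S y)| <= _).
    by rewrite cardsU1 inE (negbTE T1s) /= ltnS hit1.
  apply/subset_leq_card/subsetP=> t; rewrite in_setU1 !in_setI in_setU.
  by case/orP=> [/eqP->|/andP[-> ->]] //; rewrite Xs Rs orbT.
pose F y := [set s in S | (s + y)%R \in T1].
have cF y : y \in P -> j <= #|F y|.
  move=> Py; apply: leq_trans (hit1 y Py) _.
  rewrite -(card_sumset1 _ y); apply/subset_leq_card/subsetP=> s.
  rewrite mem_sumset1 !inE => /and3P[T1s Ss Ssy].
  have e : (s - y = s + y)%R by apply: (@addIr _ y); rewrite subrK cancel2.
  by rewrite subrK in Ssy; rewrite Ssy -e.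
have [y Py|X [sX cX hit]] := @hitting_set V V S P F j p u2 j0 Sj Pp _ cF.
  by apply/subsetP=> s; rewrite inE => /andP[].
exists (T1 :|: X); split; first by rewrite subUset sT1 sX.
  by rewrite cardsU; lia.
apply/subsetP=> y Py; have /set0Pn[s /setIP[Xs]] := hit y Py.
rewrite inE => /andP[Ss T1s].
by rewrite -(cancel2 y s) mem_sumset ?inE ?Xs ?orbT // addrC T1s.
Qed.

(* Each step adds to [X] an element [s] bringing [w] new rare sums [s + t] with [t] in [T0];
   averaging over [S] provides it as long as the sums so far exclude few pairs. *)
Lemma rare_sums_growth (V : finZmodType) (S T0 : {set V}) theta d w N :
  (forall x : V, x + x = 0)%R -> T0 \subset S -> S != set0 ->
  (forall t, t \in T0 -> d <= #|[set s in S | #|rep_set S (s + t)%R| <= theta]|) ->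
  w * #|S| + N * w * theta <= #|T0| * d ->
  exists X : {set V}, [/\ X \subset S, #|X| <= N & N * w <= #|T0 :+: X|].
Proof.
move=> char2 sT0 S0 rare bound.
have cancel2 (x y : V) : (x + y + y = x)%R by rewrite -addrA char2 addr0.
suff: forall i, i <= N -> exists X : {set V}, [/\ X \subset S, #|X| <= i &
   i * w <= #|T0 :+: X|] by apply.
elim=> [_|i IH iN]; first by exists set0; rewrite sub0set cards0.
have [X [sX cX gX]] := IH (ltnW iN).
set W := T0 :+: X in gX *.
have [big|small] := leqP (i.+1 * w) #|W|; first by exists X; split=> //; apply: leqW.
pose new s := [set t in T0 | (#|rep_set S (s + t)%R| <= theta) && ((s + t)%R \notin W)].
have [/exists_inP[s Ss ws]|no] := boolP [exists s in S, w <= #|new s|].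
  exists (s |: X); split; first by rewrite subUset sub1set Ss.
    by rewrite cardsU1; case: (s \in X); rewrite /= ?add0n ?add1n // leqW.
  apply: (@leq_trans #|W :|: ([set s] :+: new s)|).
    rewrite cardsU card_sumset1; suff -> : W :&: ([set s] :+: new s) = set0.
      by rewrite cards0 subn0 mulSn; lia.
    apply/setP=> x; rewrite !inE; apply/negP=> /andP[Wx /sumsetP[_ [t [/set1P-> + e]]]].
    by rewrite inE e in Wx * => /and3P[_ _]; rewrite Wx.
  apply/subset_leq_card; rewrite subUset; apply/andP; split.
    by rewrite sumsetSS ?subsetUr.
  apply/subsetP=> x /sumsetP[_ [t [/set1P-> + ->]]]; rewrite inE => /andP[T0t _].
  by rewrite addrC mem_sumset ?setU11.
(* Each [t] has [d] partners with a rare sum. Pairs whose rare sum is already in [W] number at most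
   [#|W| * theta], because a rare sum has at most [theta] representations. *)
have lt : \sum_(s in S) #|new s| + #|W| * theta >= #|T0| * d.
  rewrite -sum_nat_const.
  apply: (@leq_trans (\sum_(t in T0) #|[set s in S | #|rep_set S (s + t)%R| <= theta]|)).
    exact: leq_sum.
  have E (A B : {set V}) (q : V -> V -> bool) :
      \sum_(s in A) #|[set t in B | q s t]| = \sum_(s in A) \sum_(t in B) q s t.
    apply: eq_bigr => s _; rewrite -sum1dep_card big_mkcondr /=.
    by apply: eq_bigr => t _; case: (q s t).
  rewrite (E T0 S (fun t s => #|rep_set S (s + t)%R| <= theta)) exchange_big /=.
  pose old s := [set t in T0 | (#|rep_set S (s + t)%R| <= theta) && ((s + t)%R \in W)].
  apply: (@leq_trans (\sum_(s in S) (#|new s| + #|old s|))).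
    rewrite big_split /= (E S T0 (fun s t => (#|rep_set S (s + t)%R| <= theta) &&
      ((s + t)%R \notin W))) (E S T0 (fun s t => (#|rep_set S (s + t)%R| <= theta) &&
      ((s + t)%R \in W))) -big_split /=.
    apply: leq_sum => s _; rewrite -big_split /=; apply: leq_sum => t _.
    by case: (#|rep_set S (s + t)%R| <= theta); case: ((s + t)%R \in W).
  rewrite big_split /= leq_add2l.
  have -> : \sum_(s in S) #|old s| =
      \sum_(y in W) #|[set t in T0 | (#|rep_set S y| <= theta) && ((y + t)%R \in S)]|.
    rewrite (E S T0 (fun s t => (#|rep_set S (s + t)%R| <= theta) && ((s + t)%R \in W))).
    rewrite (E W T0 (fun y t => (#|rep_set S y| <= theta) && ((y + t)%R \in S))).
    rewrite exchange_big [RHS]exchange_big /=; apply: eq_bigr => t _.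
    rewrite big_mkcond [RHS]big_mkcond /=.
    have inv : involutive (fun x : V => x + t)%R by move=> x; rewrite cancel2.
    rewrite (reindex_inj (inv_inj inv)) /=; apply: eq_bigr => y _; rewrite cancel2.
    by case: (y \in W); case: ((y + t)%R \in S); case: (#|rep_set S y| <= theta).
  rewrite -sum_nat_const; apply: leq_sum => y _.
  have [le|nle] /= := boolP (#|rep_set S y| <= theta).
    apply: leq_trans le; apply/subset_leq_card/subsetP=> t.
    by rewrite !inE addrC => /andP[/(subsetP sT0)-> ->].
  by rewrite (_ : [set t in T0 | false] = set0) ?cards0 //; apply/setP=> t; rewrite !inE andbF.
have le : \sum_(s in S) #|new s| <= #|S| * w.-1.
  rewrite -sum_nat_const; apply: leq_sum => s Ss.
  by move: no; rewrite negb_exists_in => /forall_inP/(_ s Ss); rewrite -ltnNge; lia.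
have w0 : 0 < w.
  have [s Ss] := set0Pn _ S0.
  by move: no; rewrite negb_exists_in => /forall_inP/(_ s Ss); rewrite -ltnNge; lia.
have Spos : 0 < #|S| by rewrite card_gt0.
have Wle : #|W| * theta <= N * w * theta.
  by rewrite leq_mul2r (leq_trans (ltnW small)) ?orbT // leq_mul2r iN orbT.
have : #|S| * w.-1 < w * #|S| by rewrite mulnC ltn_pmul2r // prednK.
by lia.
Qed.

(** * Coordinates on the span of a set *)

Local Open Scope ring_scope.

Definition set_mx n (A : {set 'rV['F_2]_n}) : 'M['F_2]_(#|A|, n) :=
  \matrix_(i < #|A|) enum_val i.

Definition row_set r n (M : 'M['F_2]_(r, n)) : {set 'rV['F_2]_n} := [set row i M | i : 'I_r].

Lemma sub_set_mx n (A : {set 'rV['F_2]_n}) x : x \in A -> (x <= set_mx A)%MS.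
Proof.
move=> Ax; have <- : row (enum_rank_in Ax x) (set_mx A) = x.
  by rewrite rowK enum_rankK_in.
exact: row_sub.
Qed.

Lemma set_mx_sub n m (A : {set 'rV['F_2]_n}) (M : 'M['F_2]_(m, n)) :
  (forall x, x \in A -> (x <= M)%MS) -> (set_mx A <= M)%MS.
Proof. by move=> h; apply/row_subP=> i; rewrite rowK h // enum_valP. Qed.

Lemma set_mx_basis n (A : {set 'rV['F_2]_n}) :
  exists M : 'M['F_2]_(\rank (set_mx A), n),
    [/\ row_free M, row_set M \subset A & (set_mx A <= M)%MS].
Proof.
exists (rowsub (maxrankfun (set_mx A)) (set_mx A)); split.
- exact: maxrowsub_free.
- by apply/subsetP=> _ /imsetP[i _ ->]; rewrite row_rowsub rowK enum_valP.
- by rewrite eq_maxrowsub.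
Qed.

(** In characteristic 2, [A :+: A] is the difference set, so for nonempty [A] this is the dimension
    of the affine span. *)
Definition affine_rank n (A : {set 'rV['F_2]_n}) : nat := \rank (set_mx (A :+: A)).

Lemma affine_rankS n (A B : {set 'rV['F_2]_n}) :
  A \subset B -> (affine_rank A <= affine_rank B)%N.
Proof.
move=> sAB; apply/mxrankS/set_mx_sub => x Ax; apply: sub_set_mx.
exact: (subsetP (sumsetSS sAB sAB)).
Qed.

Lemma affine_rank_le n (A : {set 'rV['F_2]_n}) : (affine_rank A <= n)%N.
Proof. exact: rank_leq_col. Qed.

(** From [a + b = (s + a) + (s + b)], the translate by [s] spans the same space as the difference
    set. The basis can thus be drawn from a subset [A] of well-behaved points while spanning the
    translate of all of [S]. *)
Lemma affine_basis n (A S : {set 'rV['F_2]_n}) s : A \subset S -> s \in A ->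
  affine_rank A = affine_rank S ->
  exists M : 'M['F_2]_(affine_rank S, n),
    [/\ row_free M, row_set M \subset [set s] :+: A &
      forall x, x \in [set s] :+: S -> (x <= M)%MS].
Proof.
move=> sAS As rkE.
have sum_sub (B : {set 'rV['F_2]_n}) : s \in B ->
    (set_mx ([set s] :+: B) :=: set_mx (B :+: B))%MS.
  move=> Bs; apply/eqmxP/andP; split; apply: set_mx_sub => x /sumsetP[a [b [Ba Bb ->]]].
    by apply: sub_set_mx; move/set1P: Ba => ->; rewrite mem_sumset.
  have -> : a + b = (s + a) + (s + b) by rewrite addrACA mx_char2 add0r.
  by apply: addmx_sub; apply: sub_set_mx; rewrite mem_sumset ?set11.
have [M [freeM rowM subM]] := set_mx_basis ([set s] :+: A).
have eA : \rank (set_mx ([set s] :+: A)) = affine_rank S by rewrite sum_sub // -rkE.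
rewrite -eA; exists M; split=> // x Sx.
apply: submx_trans (sub_set_mx Sx) _; apply: submx_trans subM.
rewrite (sum_sub S) ?(subsetP sAS) // (sum_sub A) //.
have le : (set_mx (A :+: A) <= set_mx (S :+: S))%MS.
  by apply: set_mx_sub => y Ay; apply/sub_set_mx/(subsetP (sumsetSS sAS sAS)).
by rewrite -(mxrank_leqif_sup le) -/(affine_rank A) -/(affine_rank S) rkE.
Qed.

(** In the coordinates given by [M] its rows become the unit vectors, which reduces the claim to
    [vertex_expansion]. *)
Lemma expansion_basis r n l (M : 'M['F_2]_(r, n)) (S : {set 'rV['F_2]_n}) :
  row_free M -> (forall x, x \in S -> (x <= M)%MS) ->
  (16 * l <= r)%N -> (#|S| * (16 * l) ^ l < r ^ l)%N ->
  (#|S| * r <= 8 * l * #|S :+: row_set M|)%N.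
Proof.
move=> freeM SM lr.
have injM : injective (mulmx^~ M : 'rV['F_2]_r -> 'rV['F_2]_n) by exact: row_free_inj.
pose S' := [set u : 'rV['F_2]_r | u *m M \in S].
have imS : [set u *m M | u in S'] = S.
  apply/setP=> x; apply/imsetP/idP => [[u]|Sx]; first by rewrite inE => Su ->.
  have /submxP[u e] := SM x Sx.
  by exists u; rewrite ?inE -?e.
have cS : #|S'| = #|S| by rewrite -imS card_imset.
rewrite -cS => small; apply: leq_trans (vertex_expansion lr small) _.
rewrite leq_mul2l; apply/orP; right.
rewrite -(card_imset _ injM); apply/subset_leq_card/subsetP.
move=> _ /imsetP[_ /sumsetP[u [v [Su + ->]]] ->].
case/imsetP=> i _ ->; rewrite mulmxDl mem_sumset //; first by rewrite inE in Su.
by rewrite -rowE; apply/imset_f.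
Qed.

(** The set [G] of [small_doubling_closure] contains 0 and is closed under adding rows of [M], so it
    contains all [2 ^ r] of their combinations. *)
Lemma doubling_rank r n (M : 'M['F_2]_(r, n)) (B : {set 'rV['F_2]_n}) kappa :
  row_free M -> row_set M \subset B -> 0 \in B -> (#|B :+: B| <= kappa * #|B|)%N ->
  (2 ^ r <= 2 ^ (kappa ^ 3) * (kappa * #|B|))%N.
Proof.
move=> freeM rB B0 dbl.
have [G [G0 clG cG]] := small_doubling_closure (@mx_char2 1 n) B0 dbl.
apply: leq_trans cG.
have injM : injective (mulmx^~ M : 'rV['F_2]_r -> 'rV['F_2]_n) by exact: row_free_inj.
have -> : (2 ^ r = #|[set u *m M | u in [set: 'rV['F_2]_r]]|)%N.
  by rewrite card_imset // cardsT card_mx mul1n card_Fp.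
apply/subset_leq_card/subsetP=> _ /imsetP[u _ ->].
rewrite mulmx_sum_row; elim/big_rec: _ => // i x _ Gx.
apply: (subsetP clG); rewrite addrC mem_sumset //.
have : u 0 i = 0 \/ u 0 i = 1.
  by case: (u 0 i) => [[|[|]] ?]; [left; apply/val_inj|right; apply/val_inj|].
case=> ->; first by rewrite scale0r.
by rewrite scale1r (subsetP rB) //; apply/imset_f.
Qed.

Local Close Scope ring_scope.

(* When no element of [S] can be added to the generic set [T], [S] lies in [confined T]. *)
Definition confined (V : finZmodType) (T : {set V}) : {set V} :=
  [set y | #|T| <= 2 * #|([set y] :+: T) :&: (T :+: T)|].

(** Double counting: each [y] in [confined T] puts at least half of its translate of [T] inside
    [T :+: T], while each point of [T :+: T] lies in only [#|T|] translates. *)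
Lemma card_confined (V : finZmodType) (T : {set V}) :
  (forall x : V, x + x = 0)%R -> T != set0 -> #|confined T| <= 2 * #|T| ^ 2.
Proof.
move=> char2 T0; have Tpos : 0 < #|T| by rewrite card_gt0.
have cancel2 (x y : V) : (x + y + y = x)%R by rewrite -addrA char2 addr0.
have opp (x : V) : (- x = x)%R by apply/eqP; rewrite eq_sym -addr_eq0 char2.
rewrite -(leq_pmul2r Tpos).
have sumE (Q : {set V}) : \sum_(y in Q) #|([set y] :+: T) :&: (T :+: T)| <=
    \sum_(z in T :+: T) #|T|.
  have -> : \sum_(z in T :+: T) #|T| = \sum_(z in T :+: T) \sum_y ((y + z)%R \in T).
    apply: eq_bigr => z _; rewrite (reindex_inj (addIr z)) /=.
    by rewrite -sum1_card big_mkcond; apply: eq_bigr => y _; rewrite cancel2; case: ifP.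
  rewrite exchange_big /= big_mkcond /=; apply: leq_sum => y _.
  case: (y \in Q) => //; rewrite -sum1_card big_mkcond [leqRHS]big_mkcond /=.
  apply: leq_sum => z _; rewrite inE mem_sumset1 opp addrC.
  by case: ((y + z)%R \in T); case: (z \in _).
rewrite -sum_nat_const; apply: (@leq_trans (\sum_(y in confined T)
     2 * #|([set y] :+: T) :&: (T :+: T)|)).
  by apply: leq_sum => y; rewrite inE.
rewrite -big_distrr /= -mulnA leq_mul2l /=; apply: leq_trans (sumE _) _.
rewrite sum_nat_const leq_mul2r; apply/orP; right.
by rewrite (leq_trans (card_sumset_le _ _)) // expnS expn1.
Qed.

(** Take [T] of maximal size among those with a quadratically large sumset. A point outside
    [confined T] would add more than [#|T| / 2] sums, enough for the increase [2 * #|T|] of the left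
    side, so it could be adjoined. *)
Lemma generic_subset (V : finZmodType) (S : {set V}) N :
  S != set0 -> 0 < N ->
  exists T : {set V}, [/\ T \subset S, T != set0, #|T| <= N,
    #|T| * (#|T| - 1) <= 4 * #|T :+: T| & #|T| < N -> S \subset confined T].
Proof.
move=> /set0Pn[s Ss] N0.
pose P (T : {set V}) := [&& T \subset S, T != set0, #|T| <= N &
   #|T| * (#|T| - 1) <= 4 * #|T :+: T|].
have P1 : P [set s].
  rewrite /P sub1set Ss cards1 N0 /= andbT -card_gt0 cards1 //.
case: (arg_maxnP (fun T : {set V} => #|T|) P1) => T /and4P[sT T0 cT gT] maxT.
exists T; split=> // ltT; apply/subsetP=> x Sx; rewrite inE leqNgt; apply/negP=> lt.
have Tx : x \notin T.
  apply: contraL lt => Tx; rewrite -leqNgt.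
  have /setIidPl -> : [set x] :+: T \subset T :+: T by rewrite sumsetSS ?sub1set.
  by rewrite card_sumset1; lia.
suff : P (x |: T) by move/maxT; rewrite /= cardsU1 Tx add1n ltnn.
rewrite /P subUset sub1set Sx sT cardsU1 Tx add1n ltT /=; apply/andP; split.
  by apply/set0Pn; exists x; rewrite setU11.
apply: (@leq_trans (4 * #|(T :+: T) :|: ([set x] :+: T)|)).
  rewrite cardsU card_sumset1 setIC; move: lt.
  have : #|([set x] :+: T) :&: (T :+: T)| <= #|T|.
    by rewrite -(card_sumset1 T x); apply/subset_leq_card/subsetIl.
  move: #|_ :&: _| => c _; move: #|T| #|T :+: T| gT => t u.
  by rewrite mulnBr muln1 subn1 /= mulSn => ? ?; lia.
rewrite leq_mul2l /=; apply/subset_leq_card; rewrite subUset.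
by apply/andP; split; rewrite sumsetSS ?subsetUr ?subsetUl.
Qed.

(** * Structure of popular sums *)

Definition bad_partners (V : finZmodType) (S P : {set V}) (t : V) : {set V} :=
  [set x in S | (t + x)%R \notin P].

Lemma card_good_partners (V : finZmodType) (S P : {set V}) t :
  #|([set t] :+: S) :&: P| + #|bad_partners S P t| = #|S|.
Proof.
rewrite -(card_sumset1 (bad_partners S P t) t) -(card_sumset1 S t).
rewrite -[RHS](cardsID P); congr (_ + #|pred_of_set _|).
apply/setP=> x; rewrite !inE !mem_sumset1 inE andbC.
by rewrite [(t + _)%R]addrC subrK.
Qed.

(** The translates of [S] by [s] and [t] lie in [P] up to [e] points each, and they meet in a
    translate of [rep_set S (s + t)]; a rare sum makes them almost disjoint. *)
Lemma unpopular_pair_bound (V : finZmodType) (S P : {set V}) e theta s t :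
  (forall x : V, x + x = 0)%R ->
  #|bad_partners S P s| <= e -> #|bad_partners S P t| <= e ->
  #|rep_set S (s + t)%R| <= theta -> 2 * #|S| <= #|P| + 2 * e + theta.
Proof.
move=> char2 bs bt rep.
have opp (x : V) : (- x = x)%R by apply/eqP; rewrite eq_sym -addr_eq0 char2.
have := card_good_partners S P s; have := card_good_partners S P t.
set X := _ :&: P; set Y := _ :&: P => eX eY.
have sU : #|X :|: Y| <= #|P| by apply/subset_leq_card; rewrite subUset !subsetIr.
have sI : #|X :&: Y| <= theta.
  apply: leq_trans rep; rewrite -(card_sumset1 (rep_set _ _) t).
  apply/subset_leq_card/subsetP=> x; rewrite !inE !mem_sumset1 inE !opp => /andP[/andP[-> _]].
  by case/andP=> + _; rewrite -[(x + t + _)%R]addrA [(t + (s + t))%R]addrCA char2 addr0.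
by rewrite cardsU in sU; have := subset_leq_card (subsetIl X Y); lia.
Qed.

(** For [s], [t] in [A], the identity [s + t = (s + x) + (t + x)] writes the sum in at least
    [#|S| - 2 * e] ways with both terms in [P]; there are [#|P| ^ 2] pairs in all. *)
Lemma good_doubling (V : finZmodType) (S P A : {set V}) e :
  (forall x : V, x + x = 0)%R ->
  (forall t, t \in A -> #|bad_partners S P t| <= e) ->
  #|A :+: A| * (#|S| - 2 * e) <= #|P| ^ 2.
Proof.
move=> char2 bad.
pose F (y : V) := [set p : V * V | [&& p.1 \in P, p.2 \in P & (p.1 + p.2 == y)%R]].
have cF y : y \in A :+: A -> #|S| - 2 * e <= #|F y|.
  case/sumsetP=> s [t [As At ->]].
  apply: (@leq_trans #|(S :\: bad_partners S P s) :\: bad_partners S P t|).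
    rewrite setDDl cardsD; set U := _ :|: _.
    have : #|U| <= 2 * e.
      by rewrite (leq_trans (leq_card_setU _ _)) // mul2n -addnn leq_add ?bad.
    by have := subset_leq_card (subsetIr S U); lia.
  have inj : injective (fun x : V => (s + x, t + x)%R) by move=> u v [] /addrI.
  rewrite -(card_imset _ inj); apply/subset_leq_card/subsetP=> _ /imsetP[x + ->].
  rewrite !inE => /andP[+ /andP[+ Sx]]; rewrite Sx /= !negbK => -> -> /=.
  by rewrite addrACA char2 addr0.
rewrite -sum_nat_const expnS expn1 -cardsX.
apply: (@leq_trans (\sum_(y in A :+: A) #|F y|)); first exact: leq_sum.
have -> : \sum_(y in A :+: A) #|F y| =
   \sum_(y in A :+: A) \sum_(p in setX P P) ((p.1 + p.2)%R == y).
  apply: eq_bigr => y _; rewrite -sum1_card big_mkcond [RHS]big_mkcond /=.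
  apply: eq_bigr => -[u v] _; rewrite in_setX inE andbA /=.
  by case: ((u \in P) && (v \in P)) => //=; case: eqP.
rewrite exchange_big /= -sum1_card; apply: leq_sum => p _.
rewrite -big_mkcondr /= sum1dep_card -(cards1 (p.1 + p.2)%R).
by apply/subset_leq_card/subsetP=> y; rewrite !inE eq_sym => /andP[].
Qed.

Lemma common_good (V : finZmodType) (S P T0 : {set V}) e :
  (forall t, t \in T0 -> #|bad_partners S P t| <= e) ->
  exists S0 : {set V}, [/\ S0 \subset S, S0 :+: T0 \subset P & #|S| <= #|S0| + #|T0| * e].
Proof.
move=> bad; exists (S :\: \bigcup_(t in T0) bad_partners S P t); split.
- exact: subsetDl.
- apply/subsetP=> _ /sumsetP[x [t [/setDP[Sx nB] T0t ->]]].
  apply: contraR nB => nP; apply/bigcupP; exists t => //.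
  by rewrite inE Sx addrC.
- rewrite cardsD; have := subset_leq_card (subsetIr S (\bigcup_(t in T0) bad_partners S P t)).
  have := leq_card_bigcup T0 (bad_partners S P).
  have : \sum_(t in T0) #|bad_partners S P t| <= #|T0| * e.
    by rewrite -sum_nat_const; apply: leq_sum.
  by lia.
Qed.

(** First bound: either [A :+: A] lies in [P] and [2 * #|A| > 2 ^ k.+1] allows Hopf-Stiefel, or an
    unpopular sum gives two almost disjoint translates. Second: nearly all of [S] is good for every
    member of a basis taken in [A], so adding the basis expands inside [P]. Third: [A] has doubling
    at most [K ^ 2], which limits [r]. *)
Lemma popular_size n r l q e theta (S A P : {set 'rV['F_2]_n}) s (M : 'M['F_2]_(r, n)) :
  A \subset S -> s \in A -> row_free M -> row_set M \subset [set s] :+: A ->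
  (forall x, x \in [set s] :+: S -> (x <= M)%MS) ->
  (forall t, t \in A -> #|bad_partners S P t| <= e) ->
  (forall y, y \notin P -> #|rep_set S y| <= theta) ->
  (exists k, q = 2 ^ k) -> q + r * e + 2 * e + theta < #|S| -> #|S| <= 2 * q ->
  #|S| <= #|A| + e ->
  [/\ 2 * q <= #|P|,
      16 * l <= r -> #|S| * (16 * l) ^ l < r ^ l -> q * r <= 8 * l * #|P| &
      forall K, #|P| <= K * q -> 2 ^ r <= 2 ^ (K ^ 6) * (K ^ 2 * (2 * q))].
Proof.
move=> sAS As freeM rowM SM bad unpop [k ->] {q}.
set q := 2 ^ k => qS S2q cA.
have qpos : 0 < q by rewrite expn_gt0.
have char2 := @mx_char2 1 n.
split.
- have [/exists_inP[t At /exists_inP[u Au nP]]|all] :=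
    boolP [exists t in A, exists u in A, (t + u)%R \notin P].
    have := unpopular_pair_bound char2 (bad _ At) (bad _ Au) (unpop _ nP).
    by move: qS; move: (r * e) #|S| #|P| => a b c; lia.
  have sAP : A :+: A \subset P.
    apply/subsetP=> _ /sumsetP[t [u [At Au ->]]]; apply: contraNT all => nP.
    by apply/exists_inP; exists t => //; apply/exists_inP; exists u.
  apply: leq_trans (subset_leq_card sAP); rewrite -expnS; apply: sumset_power2 => //.
  + by apply/set0Pn; exists s.
  + by apply/set0Pn; exists s.
  + by rewrite expnS -/q; move: qS cA; move: (r * e) #|S| #|A| => a b c; lia.
- move=> lr small.
  have sTA : [set s] :+: row_set M \subset A.
    apply/subsetP=> x /sumsetP[_ [y [/set1P-> My ->]]].
    have /sumsetP[_ [a [/set1P-> Aa ->]]] := subsetP rowM y My.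
    by rewrite addrA char2 add0r.
  have [t /(subsetP sTA)|S0 [sS0 sP cS0]] := @common_good _ S P ([set s] :+: row_set M) e.
    exact: bad.
  have cT : #|[set s] :+: row_set M| <= r.
    by rewrite card_sumset1 (leq_trans (leq_imset_card _ _)) // card_ord.
  have cq : q <= #|S0|.
    have : #|[set s] :+: row_set M| * e <= r * e by rewrite leq_mul2r cT orbT.
    by move: qS cS0; move: (r * e) (_ * e) #|S| #|S0| => a b c d; lia.
  have sub0 : #|[set s] :+: S0| * (16 * l) ^ l < r ^ l.
    rewrite card_sumset1 (leq_ltn_trans _ small) // leq_mul2r.
    by rewrite (subset_leq_card sS0) orbT.
  have SM0 x : x \in [set s] :+: S0 -> (x <= M)%MS.
    by move=> Sx; apply: SM; apply: (subsetP (sumsetSS (subxx _) sS0)).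
  have := expansion_basis freeM SM0 lr sub0.
  rewrite card_sumset1 (sumsetC [set s] S0) -sumsetA => h.
  apply: leq_trans (leq_trans h _); first by rewrite leq_mul2r cq orbT.
  by rewrite leq_mul2l (subset_leq_card sP) orbT.
- move=> K cP.
  have cAq : q <= #|A| by move: qS cA; move: (r * e) #|S| #|A| => a b c; lia.
  have dbl := good_doubling char2 bad.
  have e1 : #|A :+: A| * q <= K ^ 2 * q * q.
    apply: leq_trans (_ : #|A :+: A| * (#|S| - 2 * e) <= _).
      rewrite leq_mul2l; apply/orP; right.
      by move: qS; move: (r * e) #|S| => a b; lia.
    apply: leq_trans dbl _; rewrite -mulnA -[q * q]/(q ^ 2) -expnMn leq_exp2r //.
  have {}e1 : #|A :+: A| <= K ^ 2 * #|A|.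
    move: e1; rewrite leq_pmul2r // => e1; apply: leq_trans e1 _.
    by rewrite leq_mul2l cAq orbT.
  have B0 : (0 : 'rV['F_2]_n)%R \in [set s] :+: A by rewrite -(char2 s) mem_sumset ?set11.
  have dbl2 : #|([set s] :+: A) :+: ([set s] :+: A)| <= K ^ 2 * #|[set s] :+: A|.
    rewrite card_sumset1 (leq_trans _ e1) //; apply/subset_leq_card/subsetP=> x.
    case/sumsetP=> _ [_ [/sumsetP[_ [a [/set1P-> Aa ->]]] /sumsetP[_ [b [/set1P-> Ab ->]]] ->]].
    by rewrite addrACA char2 add0r mem_sumset.
  have := doubling_rank freeM rowM B0 dbl2; rewrite card_sumset1 -expnM /= => h.
  apply: leq_trans h _; rewrite !leq_mul2l; apply/orP; right; apply/orP; right.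
  exact: leq_trans (subset_leq_card sAS) S2q.
Qed.

(** Three ranges. For [r] above [C * l], isoperimetry with [k = 128 * l] gives [8 * n * r <= p]. For
    smaller [r] and [p > C * q] the same holds directly. Otherwise bounded doubling gives [r <= k]
    plus a constant, and the margin [g.+1 / g] in the bound on [n * k] absorbs the excess. *)
Lemma gain_bound n k g l r x c q m p :
  k = 128 * l -> q = 2 ^ k -> 0 < l -> 0 < g -> 134 <= c ->
  g.+1 * (n * k) <= g * (2 * q) -> m <= 2 * q -> 
  16 * g * 2 ^ (6 * c) <= k -> 16 * g * x <= n -> k <= n -> 16 * g <= n ->
  2 * q <= p ->
  (16 * l <= r -> m * (16 * l) ^ l < r ^ l -> q * r <= 8 * l * p) ->
  (forall K, p <= K * q -> 2 ^ r <= 2 ^ (K ^ 6) * (K ^ 2 * (2 * q))) ->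
  r * (n + x) + 4 * k <= p.
Proof.
move=> kl qk l0 g0 c134 gnk m2q klarge xn kn gn p1 p2 p3.
have nk2q : n * k <= 2 * q.
  rewrite -(leq_pmul2l g0); apply: leq_trans gnk; rewrite mulSn; lia.
have xn' : x <= n by nia.
have qpos : 0 < q by rewrite qk expn_gt0.
have n4 : 4 <= n by nia.
have k4 : 4 * k <= p.
  by apply: leq_trans p1; apply: leq_trans nk2q; rewrite leq_mul2r n4 orbT.
have [r0|rpos] := posnP r; first by rewrite r0 mul0n.
have base y : 8 * n * r <= y -> r * (n + x) + 4 * k <= y.
  move=> h; apply: leq_trans h; rewrite mulnDr.
  have : r * x <= r * n by rewrite leq_mul2l xn' orbT.
  have : k <= n * r by rewrite (leq_trans kn) // leq_pmulr.
  by rewrite -mulnA; move: (n * r) (mulnC r n) => nr ->; lia.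
set C := 2 ^ c in klarge *.
have [big|small] := leqP (C * l) r.
  (* [(2 ^ 130) ^ l] exceeds [m <= 2 ^ k.+1] since [128 * l + 1 < 130 * l]; [134 <= c] also pays for
     the factor 16. *)
  have C16 : 16 * l * 2 ^ 130 <= C * l.
    rewrite mulnAC leq_mul2r; apply/orP; right.
    by rewrite -[16]/(2 ^ 4) -expnD leq_exp2l.
  apply: base; have lr : 16 * l <= r.
    by apply: leq_trans big; apply: leq_trans C16; rewrite leq_pmulr // expn_gt0.
  have : m * (16 * l) ^ l < r ^ l.
    apply: (@leq_trans ((16 * l * 2 ^ 130) ^ l)); last first.
      by rewrite leq_exp2r // (leq_trans C16).
    rewrite [ltnRHS](expnMn (16 * l)) [ltnRHS]mulnC ltn_pmul2r ?expn_gt0 ?muln_gt0 ?l0 //.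
    rewrite (leq_ltn_trans m2q) // qk -expnS -expnM ltn_exp2l //; lia.
  move=> /(p2 lr) h.
  have h2 : 128 * l * (n * r) <= 16 * l * p.
    have e : 128 * l * (n * r) = (n * k) * r by rewrite kl; lia.
    rewrite e; apply: leq_trans (_ : 2 * q * r <= _); first by rewrite leq_mul2r nk2q orbT.
    by rewrite -mulnA; move: h; rewrite -!mulnA; lia.
  rewrite -(leq_pmul2l (_ : 0 < 16 * l)) ?muln_gt0 ?l0 //; apply: leq_trans h2.
  by apply/eq_leq; lia.
have [pC|pC] := leqP p (C * q); last first.
  apply: base; apply: leq_trans (ltnW pC).
  have h : n * l * 64 <= q by move: nk2q; rewrite kl; lia.
  apply: leq_trans (leq_mul (leqnn C) h).
  have : n * r <= n * (C * l) by rewrite leq_mul2l ltnW ?orbT.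
  by move: C {klarge small pC} => D; lia.
have := p3 C pC; rewrite /C qk -!expnM -expnS -!expnD leq_exp2l // => rk.
set R0 := 2 ^ (c * 6) in rk.
have gR : 4 * g * (r - k) <= k.
  apply: leq_trans klarge; rewrite -[16]/(4 * 4) -!mulnA leq_mul2l /=.
  rewrite mulnCA leq_mul2l; apply/orP; right; rewrite [6 * c]mulnC -/R0.
  have : c < R0 by rewrite /R0 (leq_trans (ltn_expl c (ltnSn 1))) // leq_exp2l // leq_pmulr.
  by lia.
apply: leq_trans p1; rewrite -(leq_pmul2l g0); apply: leq_trans gnk.
have rk' : r <= k + (r - k) by lia.
move: (r - k) rk' gR => d rd gd.
apply: (@leq_trans (g * ((k + d) * (n + x) + 4 * k))).
  by rewrite leq_mul2l leq_add2r leq_mul2r rd !orbT.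
have a1 : 4 * (g * d * n) <= k * n by rewrite !mulnA leq_mul2r gd orbT.
have a2 : 16 * (g * x * k) <= n * k by rewrite !mulnA leq_mul2r xn orbT.
have a3 : 4 * (g * d * x) <= k * x by rewrite !mulnA leq_mul2r gd orbT.
have a4 : k * x <= k * n by rewrite leq_mul2l xn' orbT.
have a5 : 16 * g * k <= n * k by rewrite leq_mul2r gn orbT.
have a6 : 16 * (k * x) <= k * n.
  by rewrite mulnCA leq_mul2l (leq_trans _ xn) ?orbT // -mulnA leq_mul2l leq_pmull.
rewrite !mulnDr !mulnDl mulSn !mulnA in a1 a2 a3 a4 a5 a6 *; nia.
Qed.

(** * Witnesses for large sumsets *)

(* The set [T] is determined by [M] and the coordinates of at most [x] of its elements,
   that is, by [r * (n + x)] bits. *)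
Definition cheap_witness n s (D : {set 'rV['F_2]_n}) : Prop :=
  exists r x (M : 'M['F_2]_(r, n)) (T : {set 'rV['F_2]_n}),
    [/\ r <= n, x <= 6 * n, T != set0, #|T| <= x & forall t, t \in T -> (t <= M)%MS] /\
    T :+: T \subset D /\ r * (n + x) + s <= #|T :+: T|.

Lemma sumset_translate (V : finZmodType) (T : {set V}) s : (forall x : V, x + x = 0)%R ->
  ([set s] :+: T) :+: ([set s] :+: T) = T :+: T.
Proof.
move=> char2; rewrite -sumsetA (sumsetC T) -!sumsetA sumsetA.
suff -> : [set s] :+: [set s] = [set 0%R] :> {set V}.
  by apply/setP=> x; rewrite mem_sumset1 subr0.
apply/setP=> x; rewrite mem_sumset1 !inE subr_eq; congr (_ == _); exact: char2.
Qed.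

(** Translation by [u] leaves [T :+: T] unchanged and moves [T] into the row space of [M]. *)
Lemma translate_witness n r x s (M : 'M['F_2]_(r, n)) (S T D : {set 'rV['F_2]_n}) u :
  r <= n -> x <= 6 * n -> T \subset S -> T != set0 -> #|T| <= x ->
  (forall y, y \in [set u] :+: S -> (y <= M)%MS) ->
  T :+: T \subset D -> r * (n + x) + s <= #|T :+: T| -> cheap_witness s D.
Proof.
move=> rn xn sTS T0 Tx SM TD gain.
exists r, x, M, ([set u] :+: T); rewrite sumset_translate; last exact: mx_char2.
split=> //; split=> //; first by rewrite -card_gt0 card_sumset1 card_gt0.
  by rewrite card_sumset1.
by move=> t Tt; apply/SM/(subsetP (sumsetSS (subxx _) sTS)).
Qed.

Lemma subset_of_card (T : finType) (A : {set T}) c :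
  c <= #|A| -> exists B : {set T}, B \subset A /\ #|B| = c.
Proof.
elim: c => [_|c IH cA]; first by exists set0; rewrite sub0set cards0.
have [B [sBA cB]] := IH (ltnW cA).
have /properP[_ [x Ax Bx]] : B \proper A by rewrite properEcard sBA cB.
by exists (x |: B); rewrite subUset sub1set Ax sBA cardsU1 Bx cB.
Qed.

Lemma small_rank_witness n k l g c b (S0 : {set 'rV['F_2]_n}) :
  k = 128 * l -> b = 2 ^ (8 * l) -> 0 < l -> 0 < g -> 134 <= c ->
  #|S0| <= 2 * 2 ^ k -> g.+1 * 2 ^ k <= g * #|S0| -> affine_rank S0 <= k ^ 3 ->
  g.+1 * (n * k) <= g * (2 * 2 ^ k) -> 2 ^ k <= 2 * (n * k) ->
  1000 * g * k ^ 4 <= b -> 16 * g * 2 ^ (6 * c) <= k ->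
  cheap_witness (4 * k) (S0 :+: S0).
Proof.
move=> kl bl l0 g0 c134 S0le S0ge rk3 gnk nkge bbig klarge.
have char2 := @mx_char2 1 n.
have k1 : 128 <= k by lia.
have bpos : 0 < b by rewrite bl expn_gt0.
(* All sizes are measured in powers of [b], with [b ^ 16 = 2 ^ k]; polynomial factors up to
   [g * k ^ 4] are small against a single [b]. *)
pose B := b ^ 15.
have qB : 2 ^ k = b * B by rewrite /B -expnS bl -expnM kl; congr (2 ^ _); lia.
have Bpos : 0 < B by rewrite expn_gt0 bpos.
have kp i : i <= 4 -> k ^ i <= k ^ 4 by move=> ?; rewrite leq_pexp2l // (leq_trans _ k1).
have kb1 : 1000 * k <= b.
  by apply: leq_trans bbig; have := kp 1 isT; rewrite expn1; nia.
have kb3 : 1000 * k ^ 3 <= b.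
  by apply: leq_trans bbig; have := kp 3 isT; nia.
have gkb3 : 1000 * (g * k ^ 3) <= b.
  by apply: leq_trans bbig; have := kp 3 isT; nia.
have gkb2 : 1000 * (g * k ^ 2) <= b.
  by apply: leq_trans bbig; have := kp 2 isT; nia.
have k3 : k <= k ^ 3 by rewrite -{1}(expn1 k) leq_pexp2l // (leq_trans _ k1).
have b1000 : 1000 <= b by clear - kb1 k1; lia.
have k6 : 6 * k <= b by clear - kb1; lia.
have e78 : b * (3 * k * (2 * b ^ 7)) = 6 * k * b ^ 8.
  by rewrite (expnS b 7); move: (b ^ 7) => y; clear; lia.
have b89 : 6 * k * b ^ 8 <= b ^ 9 by rewrite (expnS b 8) leq_mul2r k6 orbT.
have bpow i j : i <= j -> b ^ i <= b ^ j by move=> ij; rewrite leq_pexp2l.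
have nB : n <= 2 * (b * B).
  have : n <= n * k by rewrite leq_pmulr; lia.
  move=> h; rewrite -qB; apply: leq_trans h _; rewrite -(leq_pmul2l g0).
  by apply: leq_trans gnk; rewrite leq_mul2r leqnSn orbT.
(* Maximality makes the affine rank robust: deleting fewer than [B] points preserves it. *)
pose f (S : {set 'rV['F_2]_n}) : int := (#|S|%:Z - (B * affine_rank S)%:Z)%R.
have := @arg_maxP _ _ _ S0 (fun S : {set _} => S \subset S0) f (subxx S0).
case=> S sS0 maxS.
set r := affine_rank S.
have rr0 : r <= affine_rank S0 by apply: affine_rankS.
have rk : r <= k ^ 3 := leq_trans rr0 rk3.
have rn : r <= n := affine_rank_le S.
have cS : #|S0| <= #|S| + k ^ 3 * B.
  have := maxS S0 (subxx _); rewrite /f -/r.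
  have : B * affine_rank S0 <= k ^ 3 * B by rewrite mulnC leq_mul2r rk3 orbT.
  by lia.
have cS2 : #|S| <= 2 * (b * B).
  by rewrite -qB; apply: leq_trans S0le; apply: subset_leq_card.
have robust (A : {set 'rV['F_2]_n}) : A \subset S -> #|S| < #|A| + B -> affine_rank A = r.
  move=> sAS lt; apply/eqP; rewrite eqn_leq affine_rankS //= leqNgt; apply/negP=> ltr.
  have := maxS A (subset_trans sAS sS0); rewrite /f -/r.
  have : B * (affine_rank A).+1 <= B * r by rewrite leq_mul2l ltr orbT.
  by rewrite mulnS; lia.
have Sbig : b * B + (2 * k ^ 3 + 4) * B < #|S|.
  rewrite -(ltn_pmul2l g0).
  have h : g * #|S0| <= g * #|S| + g * k ^ 3 * B by rewrite -mulnA -mulnDr leq_mul2l cS orbT.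
  rewrite qB in S0ge.
  have : (g * (3 * k ^ 3 + 4)) * B < b * B.
    rewrite ltn_pmul2r //; have k3pos : 0 < k ^ 3 by rewrite expn_gt0 (leq_trans _ k1).
    apply: (@leq_ltn_trans (7 * (g * k ^ 3))).
      by rewrite mulnCA leq_mul2l; move: k3pos; move: (k ^ 3) => y; clear; lia.
    have : 0 < g * k ^ 3 by rewrite muln_gt0 g0.
    by move: gkb3; move: (g * k ^ 3) => y; clear; lia.
  by move: S0ge h; clear; move: (#|S0|) (#|S|) (k ^ 3) B => ? ? ? ?; rewrite mulSn !mulnDr !mulnDl !mulnA; lia.
have [s0 Ss0] : exists s, s \in S.
  by apply/set0Pn; rewrite -card_gt0; lia.
pose P := [set y | 2 * b ^ 9 <= #|rep_set S y|].
pose A := [set t in S | #|bad_partners S P t| <= B].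
have sAS : A \subset S by apply/subsetP=> t; rewrite inE => /andP[].
have sSS : S :+: S \subset S0 :+: S0 by apply: sumsetSS.
have n16 : 1000 * g * k <= n.
  have : (1000 * g * k) * (2 * k) <= n * (2 * k).
    rewrite [n * _]mulnCA; apply: leq_trans nkge; rewrite qB.
    have B2 : 2 <= B by apply: leq_trans (bpow 1 15 isT); rewrite expn1; lia.
    rewrite (_ : 1000 * g * k * (2 * k) = 1000 * (g * k ^ 2) * 2) ?leq_mul //.
    by rewrite expnS expn1; lia.
  by rewrite leq_pmul2r //; lia.
(* With many bad points, [b ^ 12] of them and at most [b ^ 7] further points of [S] already have
   [b ^ 17] sums, against a description cost of order [k ^ 3 * b ^ 16]. *)
have [bad_many|bad_few] := leqP B #|S :\: A|.
  have [M [_ _ SM]] := affine_basis (subxx S) Ss0 erefl.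
  have [T0 [sT0 cT0]] := subset_of_card (leq_trans (bpow 12 15 isT) bad_many).
  have [||t T0t||X [sX cX gain]] :=
    @rare_sums_growth _ S T0 (2 * b ^ 9) B (b ^ 10) (b ^ 7) char2.
  - exact: subset_trans sT0 (subsetDl _ _).
  - by apply/set0Pn; exists s0.
  - have := subsetP sT0 t T0t; rewrite !inE => /andP[+ St]; rewrite St -ltnNge => /ltnW h.
    apply: leq_trans h _; apply/subset_leq_card/subsetP=> x.
    rewrite /bad_partners 2!in_set => /andP[Sx]; rewrite in_set -ltnNge => lt9.
    by rewrite Sx addrC ltnW.
  - rewrite cT0; apply: (@leq_trans (b ^ 10 * (2 * (b * B)) + b ^ 7 * b ^ 10 * (2 * b ^ 9))).
      by rewrite leq_add2r leq_mul2l cS2 orbT.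
    have -> : b ^ 7 * b ^ 10 * (2 * b ^ 9) = 2 * b ^ 26 by rewrite mulnCA -!expnD.
    have -> : b ^ 10 * (2 * (b * B)) = 2 * b ^ 26 by rewrite /B mulnCA -expnS -expnD.
    rewrite /B -expnD -mulnDl (expnS b 26) leq_mul2r; apply/orP; right.
    by apply: leq_trans b1000.
  apply: (@translate_witness n r (2 * b ^ 12) _ M S (T0 :|: X) _ s0) => //.
  - have : 2 * b ^ 12 * (2 * k) <= 6 * n * (2 * k); last by rewrite leq_pmul2r // muln_gt0 (leq_trans _ k1).
    rewrite [6 * n * _](_ : _ = 6 * (2 * (n * k))); last by clear; lia.
    apply: leq_trans (leq_mul (leqnn 6) nkge); rewrite qB.
    have b12 : b ^ 12 <= B by apply: bpow.
    rewrite [leqLHS](_ : _ = 4 * (k * b ^ 12)); last by clear; lia.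
    have kb : k <= b by apply: leq_trans kb1; rewrite leq_pmull.
    by apply: leq_mul => //; apply: leq_mul.
  - by rewrite subUset sX (subset_trans sT0 (subsetDl _ _)).
  - rewrite -card_gt0 (leq_trans _ (subset_leq_card (subsetUl T0 X))) //.
    by rewrite cT0 expn_gt0 bpos.
  - rewrite (leq_trans (leq_card_setU _ _)) // cT0 mul2n -addnn leq_add2l.
    by rewrite (leq_trans cX) // bpow.
  - apply: subset_trans sSS; apply: sumsetSS; rewrite subUset sX andbT;
      exact: subset_trans sT0 (subsetDl _ _).
  - apply: leq_trans (subset_leq_card (sumsetSS (subsetUl T0 X) (subsetUr T0 X))).
    apply: leq_trans gain; rewrite -expnD.
    have e17 : b ^ 17 = b * (b * B) by rewrite /B -!expnS.
    rewrite e17; apply: (@leq_trans (5 * k ^ 3 * (b * B))); last first.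
      rewrite leq_mul2r (leq_trans _ kb3) ?orbT // leq_mul2r orbT //.
    have : n + 2 * b ^ 12 <= 4 * (b * B).
      have : b ^ 12 <= b * B by rewrite /B -expnS bpow.
      by move: nB; move: (b * B) (b ^ 12) => y z; clear; lia.
    move: (n + _) => y y4; have : r * y <= k ^ 3 * (4 * (b * B)) by apply: leq_mul.
    have : 4 * k <= k ^ 3 * (b * B).
      rewrite mulnC leq_mul //; apply: leq_trans (_ : b * 1 <= _); last by rewrite leq_mul2l Bpos orbT.
      by rewrite muln1 (leq_trans _ b1000).
    by move: (r * y) (k ^ 3) (b * B) => z t w; clear; lia.
have cA : #|S| <= #|A| + B.
  by have := cardsID A S; rewrite (setIidPr sAS); lia.
have cA' : #|S| < #|A| + B.
  by have := cardsID A S; rewrite (setIidPr sAS); lia.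
(* Fewer than [B] points were removed, so [A] keeps the affine rank of [S] and a basis can be chosen
   among good points. *)
have rA := robust A sAS cA'.
have [s As] : exists s, s \in A.
  apply/set0Pn; rewrite -card_gt0; move: Sbig cA'; move: #|S| #|A| (b * B) => y z t h1 h2.
  rewrite -(ltn_add2r B) add0n (leq_ltn_trans _ h2) //.
  by apply: leq_trans (ltnW h1); rewrite (leq_trans _ (leq_addl _ _)) // leq_pmull // addn_gt0 orbT.
have [M [freeM rowM SM]] := affine_basis sAS As rA.
have cP : #|P| < 2 ^ (3 * k).
  apply: (@leq_ltn_trans (#|S| * #|S|)).
    apply: leq_trans (card_sumset_le S S); apply/subset_leq_card/subsetP=> y.
    rewrite inE => h; have /set0Pn[x] : rep_set S y != set0.
      by rewrite -card_gt0 (leq_trans _ h) // muln_gt0 expn_gt0 bpos.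
    rewrite inE => /andP[Sx Sxy]; apply/sumsetP; exists x, (x + y)%R; split=> //.
    by rewrite addrA char2 add0r.
  apply: (@leq_ltn_trans ((2 * 2 ^ k) * (2 * 2 ^ k))); first by rewrite qB leq_mul.
  by rewrite -expnS -expnD ltn_exp2l //; clear - k1; lia.
have b9 : b ^ 9 <= B by apply: bpow.
have b9pos : 0 < b ^ 9 by rewrite expn_gt0 bpos.
(* The exponents balance both rounds: they cost [6 * k * b ^ 8] and [6 * k * B] points, together at
   most [7 * k * B]. This is small against [n], as [n * k] has order [b * B]. *)
have [y||||T [sT cT PT]] :=
  @popular_cover _ S P (b ^ 9) b (3 * k) (2 * b ^ 7) (2 * B) char2 b9pos bpos cP.
- by rewrite inE.
- by rewrite e78.
- apply: leq_trans cS2 _; rewrite -mulnA -expnD /B -expnS //.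
- by apply: leq_trans cS2 _; rewrite mulnAC mulnA.
have cP' : #|T| <= 7 * k * B.
  apply: leq_trans cT _; rewrite e78.
  have h : 6 * k * b ^ 8 <= B := leq_trans b89 b9.
  have h2 : B <= k * B by rewrite leq_pmull // (leq_trans _ k1).
  by move: (6 * k * _) h h2 => y; clear; lia.
have x16 : 16 * g * (7 * k * B) <= n.
  have : 16 * g * (7 * k * B) * (2 * k) <= n * (2 * k); last by rewrite leq_pmul2r // muln_gt0 (leq_trans _ k1).
  rewrite [n * _]mulnCA; apply: leq_trans nkge; rewrite qB.
  have -> : 16 * g * (7 * k * B) * (2 * k) = (224 * (g * k ^ 2)) * B.
    by rewrite expnS expn1; clear; lia.
  by rewrite leq_mul2r (leq_trans _ gkb2) ?orbT // leq_mul2r orbT.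
have Tne : T != set0.
  apply/eqP=> T0; move: PT; rewrite T0 sumset0l subset0 => /eqP P0.
  have : B < #|bad_partners S P s|.
    have := card_good_partners S P s; rewrite P0 setI0 cards0 add0n => ->.
    apply: leq_ltn_trans Sbig; rewrite -[leqLHS]mul1n -mulnDl leq_mul2r.
    by apply/orP; right; apply: leq_trans bpos (leq_addr _ _).
  by move: As; rewrite inE => /andP[_]; rewrite leqNgt => /negP.
apply: (@translate_witness n r (7 * k * B) _ M S T _ s) => //.
- by apply: leq_trans (leq_trans _ x16) _; rewrite leq_pmull // muln_gt0 g0.
- exact: subset_trans (sumsetSS sT sT) sSS.
apply: leq_trans (subset_leq_card PT).
have [] := @popular_size n r l (2 ^ k) B (2 * b ^ 9) S A P s M sAS As freeM rowM SM.
- by move=> t; rewrite inE => /andP[].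
- by move=> y; rewrite inE -ltnNge => /ltnW.
- by exists k.
- rewrite qB; apply: leq_ltn_trans Sbig.
  have h : r * B <= k ^ 3 * B by rewrite leq_mul2r rk orbT.
  rewrite -!addnA leq_add2l; move: h b9.
  by move: (k ^ 3) (r * B) (b ^ 9) => y z t; clear; lia.
- by rewrite qB.
- exact: cA.
move=> p1 p2 p3.
have nbig i : i <= 1000 * g * k -> i <= n by move=> h; apply: leq_trans n16.
apply: (@gain_bound n k g l r (7 * k * B) c (2 ^ k) #|S| #|P|) => //.
- by rewrite qB.
- by apply: nbig; rewrite leq_pmull // muln_gt0 g0.
- by apply: nbig; rewrite -mulnA leq_mul // leq_pmulr // (leq_trans _ k1).
Qed.

(** * Union bounds over short descriptions *)

Lemma card_supersets (T : finType) (W : {set T}) :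
  #|[set A : {set T} | W \subset A]| * 2 ^ #|W| = 2 ^ #|T|.
Proof.
have -> : #|[set A : {set T} | W \subset A]| = #|powerset (~: W)|.
  rewrite -(card_imset _ (inv_inj (@setCK T))); congr #|pred_of_set _|.
  apply/setP=> A; rewrite inE; apply/imsetP/idP => [[B]|sA].
    by rewrite inE => sWB ->; rewrite setCS.
  by exists (~: A); rewrite ?setCK // inE -setCS setCK.
by rewrite card_powerset -expnD addnC cardsC.
Qed.

Lemma union_bound (T I : finType) (W : I -> {set T}) (J : {set I}) w :
  (forall i, i \in J -> w <= #|W i|) ->
  #|[set A : {set T} | [exists i in J, W i \subset A]]| * 2 ^ w <= #|I| * 2 ^ #|T|.
Proof.
move=> wW; apply: (@leq_trans ((\sum_(i in J) #|[set A : {set T} | W i \subset A]|) * 2 ^ w)).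
  rewrite leq_mul2r; apply/orP; right; apply: leq_trans (leq_card_bigcup _ _).
  apply/subset_leq_card/subsetP=> A; rewrite inE => /exists_inP[i Ji sW].
  by apply/bigcupP; exists i; rewrite ?inE.
rewrite big_distrl /=; apply: (@leq_trans (\sum_(i in J) 2 ^ #|T|)).
  by apply: leq_sum => i Ji; rewrite -(card_supersets (W i)) leq_mul2l leq_exp2l ?wW ?orbT.
by rewrite sum_nat_const leq_mul2r max_card orbT.
Qed.

(** The default [t0] pads the list of elements of [T] to length [x], so that one matrix format
    serves all sizes up to [x]. *)
Lemma row_set_surj n x (T : {set 'rV['F_2]_n}) : T != set0 -> #|T| <= x ->
  exists N : 'M['F_2]_(x, n), row_set N = T.
Proof.
case/set0Pn=> t0 Tt0 Tx; exists (\matrix_(i < x) nth t0 (enum T) i)%R.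
apply/setP=> t; apply/imsetP/idP => [[i _ ->]|Tt].
  rewrite rowK; have [lt|ge] := ltnP i (size (enum T)); last by rewrite nth_default.
  by rewrite -mem_enum mem_nth.
have lt : index t (enum T) < x by rewrite (leq_trans _ Tx) // cardE index_mem mem_enum.
by exists (Ordinal lt) => //; rewrite rowK /= nth_index // mem_enum.
Qed.

Lemma row_set_sub n x r (N : 'M['F_2]_(x, n)) (M : 'M['F_2]_(r, n)) :
  (forall t, t \in row_set N -> (t <= M)%MS) -> exists c, N = (c *m M)%R.
Proof.
by move=> h; apply/submxP/row_subP => i; apply: h; apply: imset_f.
Qed.

Lemma leq_card_setD1 (T : finType) (A : {set T}) x : #|A|.-1 <= #|A :\ x|.
Proof. by rewrite [#|A|](cardsD1 x); case: (x \in A); rewrite /= ?add0n ?leq_pred. Qed.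

Definition cheap_event n s r x : {set {set 'rV['F_2]_n}} :=
  [set A : {set _} | [exists p in [set p : 'M['F_2]_(r, n) * 'M['F_2]_(x, r) |
       r * (n + x) + s <= #|row_set (p.2 *m p.1)%R :+: row_set (p.2 *m p.1)%R|],
     (row_set (p.2 *m p.1)%R :+: row_set (p.2 *m p.1)%R) :\ 0%R \subset A]].

(** There are [2 ^ (r * (n + x))] pairs of matrices, and removing 0 from a sumset may cost one
    element, hence [s.-1]. *)
Lemma card_cheap_event n s r x : 0 < s ->
  #|cheap_event n s r x| * 2 ^ s.-1 <= 2 ^ #|{: 'rV['F_2]_n}|.
Proof.
move=> s0.
have := @union_bound _ _ (fun p : 'M['F_2]_(r, n) * 'M['F_2]_(x, r) =>
    (row_set (p.2 *m p.1)%R :+: row_set (p.2 *m p.1)%R) :\ 0%R)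
  [set p : 'M['F_2]_(r, n) * 'M['F_2]_(x, r) |
       r * (n + x) + s <= #|row_set (p.2 *m p.1)%R :+: row_set (p.2 *m p.1)%R|]
  (r * (n + x) + s.-1).
rewrite -/(cheap_event n s r x) => h.
rewrite -(leq_pmul2l (_ : 0 < 2 ^ (r * (n + x)))) ?expn_gt0 // mulnCA -expnD.
have -> : 2 ^ (r * (n + x)) = #|{: 'M['F_2]_(r, n) * 'M['F_2]_(x, r)}|.
  by rewrite card_prod !card_mx !card_Fp // -expnD mulnDr [x * r]mulnC.
apply: h => p; rewrite inE => h.
by apply: leq_trans (leq_card_setD1 _ _); move: h s0; clear; lia.
Qed.

Lemma cheap_witness_event n s (D A : {set 'rV['F_2]_n}) :
  cheap_witness s D -> D :\ 0%R \subset A ->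
  exists r x, [/\ r < n.+1, x < (6 * n).+1 & A \in cheap_event n s r x].
Proof.
case=> r [x [M [T [[rn x6 T0 Tx TM] [TD gain]]]]] DA; exists r, x; split=> //.
have [N eN] := row_set_surj T0 Tx.
have [c ec] : exists c, N = (c *m M)%R by apply: row_set_sub; rewrite eN.
rewrite inE; apply/exists_inP; exists (M, c); rewrite ?inE /= -ec eN //.
exact: subset_trans (setSD _ TD) DA.
Qed.

(** [M] and [T] cost at most [7 * n * r] bits, and each point of [S] only the logarithm of the size
    of [confined T]. For [r > k ^ 3] the total stays below the [8 * n * r] forced elements. *)
Definition rich_witness n m k (D : {set 'rV['F_2]_n}) : Prop :=
  exists r (M : 'M['F_2]_(r, n)) (T S : {set 'rV['F_2]_n}),
    [/\ r <= n, k ^ 3 < r, T != set0, #|T| <= 6 * n & forall t, t \in T -> (t <= M)%MS] /\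
    [/\ S \subset confined T, #|S| = m, S :+: row_set M \subset D &
      8 * n * r <= #|S :+: row_set M|].

(** Indices beyond the size of [confined T] give 0; what matters is that every relevant [S] has some
    code. *)
Definition coded_set n q m (T : {set 'rV['F_2]_n}) (f : {ffun 'I_m -> 'I_q}) :
    {set 'rV['F_2]_n} :=
  [set nth 0%R (enum (confined T)) (f i) | i : 'I_m].

Lemma coded_set_surj n q m (T S : {set 'rV['F_2]_n}) :
  S \subset confined T -> #|S| = m -> #|confined T| <= q ->
  exists f : {ffun 'I_m -> 'I_q}, coded_set T f = S.
Proof.
move=> sS <- cq.
have lt (i : 'I_#|S|) : index (enum_val i) (enum (confined T)) < q.
  by rewrite (leq_trans _ cq) // cardE index_mem mem_enum (subsetP sS) // enum_valP.
exists [ffun i => Ordinal (lt i)]; apply/setP=> x; apply/imsetP/idP => [[i _ ->]|Sx].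
  by rewrite ffunE /= nth_index ?enum_valP // mem_enum (subsetP sS) // enum_valP.
exists (enum_rank_in Sx x) => //; rewrite ffunE /= enum_rankK_in //.
by rewrite nth_index // mem_enum (subsetP sS).
Qed.

(** [72 * n ^ 2] is [2 * (6 * n) ^ 2], the bound of [card_confined] when [#|T| <= 6 * n]. *)
Definition rich_event n m r : {set {set 'rV['F_2]_n}} :=
  let S p := coded_set (row_set (p.1.2 *m p.1.1)%R) p.2 in
  [set A : {set _} | [exists p in [set p : 'M['F_2]_(r, n) * 'M['F_2]_(6 * n, r) *
         {ffun 'I_m -> 'I_(72 * n ^ 2)} | 8 * n * r <= #|S p :+: row_set p.1.1|],
     (S p :+: row_set p.1.1) :\ 0%R \subset A]].

Lemma card_rich_event n m k r : 0 < n * r -> 128 <= k -> k ^ 3 < r -> m <= 4 * (n * k) ->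
  72 * n ^ 2 <= 2 ^ (3 * k) -> k <= n ->
  #|rich_event n m r| * 2 ^ (4 * k).-1 <= 2 ^ #|{: 'rV['F_2]_n}|.
Proof.
move=> nr k1 k3r mnk q3k kn.
have := @union_bound _ _ (fun p : 'M['F_2]_(r, n) * 'M['F_2]_(6 * n, r) *
         {ffun 'I_m -> 'I_(72 * n ^ 2)} =>
    (coded_set (row_set (p.1.2 *m p.1.1)%R) p.2 :+: row_set p.1.1) :\ 0%R)
  [set p : 'M['F_2]_(r, n) * 'M['F_2]_(6 * n, r) * {ffun 'I_m -> 'I_(72 * n ^ 2)} |
     8 * n * r <= #|coded_set (row_set (p.1.2 *m p.1.1)%R) p.2 :+: row_set p.1.1|]
  (8 * n * r).-1.
rewrite -/(rich_event n m r) => h.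
have {}h : #|rich_event n m r| * 2 ^ (8 * n * r).-1 <=
    2 ^ (7 * n * r + 3 * k * (4 * (n * k))) * 2 ^ #|{: 'rV['F_2]_n}|.
  apply: leq_trans (h _) _.
    by move=> p; rewrite inE => hp; apply: leq_trans (leq_card_setD1 _ _); rewrite -!subn1 leq_sub2r.
  rewrite leq_mul2r; apply/orP; right.
  rewrite !card_prod !card_mx !card_Fp // card_ffun !card_ord -expnD [leqRHS]expnD.
  apply: leq_mul; first by rewrite leq_exp2l //; clear; lia.
  rewrite expnM; apply: (@leq_trans ((2 ^ (3 * k)) ^ m)); last by rewrite leq_pexp2l ?expn_gt0.
  by case: (posnP m) => [->//|m0]; rewrite leq_exp2r.
rewrite -(leq_pmul2l (_ : 0 < 2 ^ (7 * n * r + 3 * k * (4 * (n * k))))) ?expn_gt0 //.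
apply: leq_trans h; rewrite mulnCA leq_mul2l -expnD leq_exp2l //; apply/orP; right.
have k2r : 13 * k ^ 2 <= r.
  by apply: leq_trans (ltnW k3r); rewrite (expnS k 2) leq_mul2r (leq_trans _ k1) ?orbT.
have kk : 4 * k <= n * k ^ 2.
  by rewrite [leqLHS]mulnC expnS expn1 mulnCA leq_mul2l; apply/orP; right; clear - kn k1; nia.
have h1 : 13 * (n * k ^ 2) <= n * r by rewrite mulnCA leq_mul2l k2r orbT.
have e1 : 3 * k * (4 * (n * k)) = 12 * (n * k ^ 2) by rewrite expnS expn1; clear; lia.
rewrite e1 -!mulnA; move: nr kk h1; move: (n * r) (n * k ^ 2) => y z; clear; lia.
Qed.

Lemma rich_witness_event n m k (D A : {set 'rV['F_2]_n}) :
  rich_witness m k D -> D :\ 0%R \subset A ->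
  exists r, [/\ r < n.+1, k ^ 3 < r & A \in rich_event n m r].
Proof.
case=> r [M [T [S [[rn kr T0 T6 TM] [ST Sm SD gain]]]]] DA; exists r; split=> //.
have [N eN] := row_set_surj T0 T6.
have [c ec] : exists c, N = (c *m M)%R by apply: row_set_sub; rewrite eN.
have cq : #|confined T| <= 72 * n ^ 2.
  apply: leq_trans (card_confined (@mx_char2 1 n) T0) _.
  rewrite -[72]/(2 * 6 ^ 2) -mulnA -expnMn leq_mul2l /= leq_exp2r //.
have [f ef] := coded_set_surj ST Sm cq.
rewrite inE; apply/exists_inP; exists (M, c, f); rewrite ?inE /= -ec eN ef //.
exact: subset_trans (setSD _ SD) DA.
Qed.

(** If the generic set reaches size [6 * n], its sumset has about [9 * n ^ 2] elements, more than
    the [n * (n + 6 * n)] bits of a trivial description with [M] the identity. If it stops earlier,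
    it confines a translate of [S0]. *)
Lemma large_rank_witness n k l g c (S0 : {set 'rV['F_2]_n}) :
  k = 128 * l -> 0 < l -> 0 < g -> 134 <= c -> k <= n ->
  2 ^ k <= #|S0| -> #|S0| <= 2 * 2 ^ k -> k ^ 3 < affine_rank S0 ->
  n * k <= 2 * 2 ^ k -> 16 * g * 2 ^ (6 * c) <= k ->
  cheap_witness (4 * k) (S0 :+: S0) \/ rich_witness #|S0| k (S0 :+: S0).
Proof.
move=> kl l0 g0 c134 kn S0ge S0le rk3 nk klarge.
have char2 := @mx_char2 1 n.
have k1 : 128 <= k by clear - kl l0; lia.
have [s Ss] : exists s, s \in S0.
  by apply/set0Pn; rewrite -card_gt0 (leq_trans _ S0ge) // expn_gt0.
have [M [freeM rowM SM]] := affine_basis (subxx S0) Ss erefl.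
set r := affine_rank S0 in M freeM rowM SM rk3.
have S1 : [set s] :+: S0 != set0 by rewrite -card_gt0 card_sumset1 (leq_trans _ S0ge) ?expn_gt0.
have n6 : 0 < 6 * n by clear - kn k1; lia.
have [T [sT T0 Tx gT stuck]] := generic_subset S1 n6.
have TD : T :+: T \subset S0 :+: S0.
  by rewrite -(sumset_translate S0 s char2) sumsetSS.
have [lt|ge] := ltnP #|T| (6 * n); last first.
  left; exists n, (6 * n), 1%:M%R, T; split; first by split=> // t _; apply: submx1.
  split=> //; have eT : #|T| = 6 * n by apply/eqP; rewrite eqn_leq Tx.
  by move: gT; rewrite eT; move: #|_| => y; clear - kn k1; nia.
right; exists r, M, T, ([set s] :+: S0); split.
  split=> //; first exact: affine_rank_le.
  by move=> t Tt; apply/SM/(subsetP sT).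
split.
- exact: stuck.
- by rewrite card_sumset1.
- rewrite -(sumset_translate S0 s char2) sumsetSS //.
- have C16 : 16 * l * 2 ^ 130 <= r.
    apply: leq_trans (ltnW rk3).
    have : 2 ^ 134 <= k.
      apply: leq_trans klarge; apply: (@leq_trans (2 ^ (6 * c))); last by rewrite leq_pmull ?muln_gt0.
      by rewrite leq_exp2l // (leq_trans c134) // leq_pmull.
    rewrite (_ : 134 = 4 + 130) // expnD => k134.
    rewrite mulnAC (expnS k 2) leq_mul // (leq_trans _ (_ : k <= _)) //.
      by rewrite kl leq_pmull.
    by rewrite expnS expn1 leq_pmulr // (leq_trans _ k1).
  have lr : 16 * l <= r.
    by apply: leq_trans C16; rewrite leq_pmulr // expn_gt0.
  have small : #|[set s] :+: S0| * (16 * l) ^ l < r ^ l.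
    rewrite card_sumset1.
    apply: (@leq_trans ((16 * l * 2 ^ 130) ^ l)); last first.
      by rewrite leq_exp2r.
    rewrite [ltnRHS](expnMn (16 * l)) [ltnRHS]mulnC ltn_pmul2r ?expn_gt0 ?muln_gt0 ?l0 //.
    rewrite (leq_ltn_trans S0le) // -expnS -expnM ltn_exp2l //; clear - l0 kl; lia.
  have := expansion_basis freeM SM lr small; rewrite card_sumset1.
  move: #|_ :+: row_set M| => p h.
  have h1 : n * k * r <= 16 * l * p.
    apply: leq_trans (_ : 2 * #|S0| * r <= _).
      by rewrite leq_mul2r (leq_trans nk) ?orbT // leq_mul2l.
    by rewrite -mulnA; move: h; move: (#|S0| * r) => y; clear; lia.
  rewrite -(leq_pmul2l (_ : 0 < 16 * l)) ?muln_gt0 ?l0 //; apply: leq_trans h1.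
  by rewrite kl; apply/eq_leq; clear; lia.
Qed.

(** Small affine rank yields a cheap witness, large rank a cheap or a rich one. Each [r] has
    [(6 * n).+1] cheap events and one rich event, whence the factor [(6 * n).+2]. *)
Lemma card_sumset_event n k l g c b m :
  k = 128 * l -> b = 2 ^ (8 * l) -> 0 < l -> 0 < g -> 134 <= c -> k <= n ->
  m <= 2 * 2 ^ k -> g.+1 * 2 ^ k <= g * m ->
  g.+1 * (n * k) <= g * (2 * 2 ^ k) -> 2 ^ k <= 2 * (n * k) ->
  1000 * g * k ^ 4 <= b -> 16 * g * 2 ^ (6 * c) <= k ->
  #|[set A : {set 'rV['F_2]_n} | [exists S : {set _},
      (#|S| == m) && ((S :+: S) :\ 0%R \subset A)]]| * 2 ^ (4 * k).-1 <=
  n.+1 * (6 * n).+2 * 2 ^ #|{: 'rV['F_2]_n}|.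
Proof.
move=> kl bl l0 g0 c134 kn mle mge gnk nkge bbig klarge.
have k1 : 128 <= k by clear - kl l0; lia.
have kpos : 0 < (4 * k) by clear - k1; lia.
have nk : n * k <= 2 * 2 ^ k.
  by rewrite -(leq_pmul2l g0); apply: leq_trans gnk; rewrite leq_mul2r leqnSn orbT.
have mge' : 2 ^ k <= m.
  by rewrite -(leq_pmul2l g0); apply: leq_trans mge; rewrite leq_mul2r leqnSn orbT.
set E := [set A | _]; set N := #|{: 'rV['F_2]_n}|.
pose E1 := \bigcup_(p in [set: 'I_n.+1 * 'I_(6 * n).+1]) cheap_event n (4 * k) p.1 p.2.
pose E2 := \bigcup_(r in [set r : 'I_n.+1 | k ^ 3 < r]) rich_event n m r.
have sE : E \subset E1 :|: E2.
  apply/subsetP=> A; rewrite inE => /existsP[S /andP[/eqP Sm SA]].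
  have : cheap_witness (4 * k) (S :+: S) \/ rich_witness m k (S :+: S).
    have [rk|rk] := leqP (affine_rank S) (k ^ 3).
      by left; apply: (@small_rank_witness n k l g c b); rewrite ?Sm.
    by rewrite -Sm; apply: (@large_rank_witness n k l g c); rewrite ?Sm.
  case=> [/cheap_witness_event/(_ SA)[r [x [rn xn EA]]]|/rich_witness_event/(_ SA)[r [rn kr EA]]].
    by apply/setUP; left; apply/bigcupP; exists (Ordinal rn, Ordinal xn).
  by apply/setUP; right; apply/bigcupP; exists (Ordinal rn); rewrite // inE.
apply: (@leq_trans ((#|E1| + #|E2|) * 2 ^ (4 * k).-1)).
  by rewrite leq_mul2r; apply/orP; right; apply: leq_trans (subset_leq_card sE) _; apply: leq_card_setU.
have e6 : (6 * n).+2 = (6 * n).+1 + 1 by rewrite addn1.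
rewrite mulnDl e6 [n.+1 * _]mulnDr muln1 [leqRHS]mulnDl; apply: leq_add.
  apply: leq_trans (leq_mul (leq_card_bigcup _ _) (leqnn _)) _.
  rewrite big_distrl /=; apply: (@leq_trans (\sum_(p in [set: 'I_n.+1 * 'I_(6 * n).+1]) 2 ^ N)).
    by apply: leq_sum => p _; apply: card_cheap_event.
  by rewrite sum_nat_const cardsT card_prod !card_ord.
apply: leq_trans (leq_mul (leq_card_bigcup _ _) (leqnn _)) _.
rewrite big_distrl /=; apply: (@leq_trans (\sum_(r in [set r : 'I_n.+1 | k ^ 3 < r]) 2 ^ N)).
  apply: leq_sum => r; rewrite inE => kr; apply: (@card_rich_event n m k r _ k1 kr _ _ kn).
  - by rewrite muln_gt0 (leq_trans _ kn) ?(leq_trans _ k1) // (leq_ltn_trans (leq0n _) kr).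
  - by apply: leq_trans mle _; move: nkge; move: (2 ^ k) (n * k) => y z; clear; lia.
  - have n2 : n * 64 <= 2 ^ k.
      have : n * 128 <= n * k by rewrite leq_mul2l k1 orbT.
      by move: nk; move: (2 ^ k) (n * k) => y z; clear; lia.
    apply: (@leq_trans ((2 ^ k) ^ 2)); last by rewrite -expnM leq_exp2l //; clear; lia.
    apply: leq_trans (_ : (n * 64) ^ 2 <= _); last by rewrite leq_exp2r.
    by rewrite expnMn mulnC leq_mul2l orbT.
by rewrite sum_nat_const leq_mul2r (leq_trans (max_card _)) ?orbT // card_ord.
Qed.

(** * The second moment of the number of subspaces *)

(* Chebyshev's inequality for the number of [i] with [W i \subset A], [A] uniform. *)
Lemma second_moment (T I : finType) (W : I -> {set T}) a :
  (forall i, #|W i| = a) ->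
  #|[set A : {set T} | [forall i, ~~ (W i \subset A)]]| * #|I| ^ 2 + 2 ^ #|T| * #|I| ^ 2 <=
  2 ^ #|T| * \sum_i \sum_j 2 ^ #|W i :&: W j|.
Proof.
move=> Wa; set Z := [set A : {set T} | _]; set L := #|I|; set N := 2 ^ #|T|.
(* The scaling by [2 ^ a] makes the mean the integer [L] and the second moment the average of
   [2 ^ #|W i :&: W j|] times [L ^ 2]. *)
pose X (A : {set T}) := (\sum_i (W i \subset A)) * 2 ^ a.
have cardE (B : {set T}) : \sum_(A : {set T}) (B \subset A) * 2 ^ #|B| = N.
  rewrite -big_distrl /= /N -(card_supersets B); congr (_ * _).
  rewrite -sum1_card [RHS]big_mkcond /=; apply: eq_bigr => A _.
  by rewrite inE; case: (B \subset A).
have S1 : \sum_A X A = L * N.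
  rewrite /X (eq_bigr (fun A : {set T} => \sum_i (W i \subset A) * 2 ^ a)); last first.
    by move=> A _; rewrite big_distrl.
  rewrite exchange_big /= (eq_bigr (fun _ => N)) ?sum_nat_const //.
  by move=> i _; rewrite -(cardE (W i)) Wa.
have S2 : \sum_A X A ^ 2 = N * \sum_i \sum_j 2 ^ #|W i :&: W j|.
  rewrite (eq_bigr (fun A : {set T} => \sum_i \sum_j
     ((W i :|: W j) \subset A) * 2 ^ (a + a))); last first.
    move=> A _; rewrite /X expnMn -expnM muln2 -addnn -mulnn big_distrlr /= big_distrl /=.
    apply: eq_bigr => i _; rewrite big_distrl /=; apply: eq_bigr => j _.
    by rewrite subUset; case: (W i \subset A); case: (W j \subset A).
  rewrite exchange_big big_distrr /=; apply: eq_bigr => i _.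
  rewrite exchange_big big_distrr /=; apply: eq_bigr => j _.
  rewrite -(cardE (W i :|: W j)) big_distrl /=; apply: eq_bigr => A _.
  rewrite -mulnA -expnD; congr (_ * 2 ^ _); rewrite cardsU !Wa subnK //.
  by rewrite (leq_trans (subset_leq_card (subsetIl _ _))) ?Wa ?leq_addr.
rewrite -S2.
have var : (\sum_A ((X A)%:Z - L%:Z) ^+ 2 = (\sum_A X A ^ 2)%:Z - (N * L ^ 2)%:Z)%R.
  rewrite (eq_bigr (fun A => (X A ^ 2)%:Z + ((L ^ 2)%:Z - (2 * L)%:Z * (X A)%:Z))%R); last first.
    by move=> A _; rewrite !PoszM; ring.
  rewrite big_split /= sumrB -!(big_morph Posz PoszD (erefl (Posz 0))).
  have cT : #|{: {set T}}| = N by rewrite -cardsT -powersetT card_powerset cardsT.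
  have S1' : \sum_A 2 * L * X A = 2 * L * (L * N) by rewrite -big_distrr /= S1.
  by rewrite S1' sum_nat_const cT !PoszM; ring.
have low : ((#|Z| * L ^ 2)%:Z <= \sum_A ((X A)%:Z - L%:Z) ^+ 2)%R.
  rewrite (bigID (fun A => A \in Z)) /= -[leLHS]addr0; apply: lerD; last first.
    by apply: sumr_ge0 => A _; apply: sqr_ge0.
  rewrite (eq_bigr (fun _ => Posz (L ^ 2))); last first.
    move=> A; rewrite inE => /forallP none; rewrite /X big1 ?mul0n; last first.
      by move=> i _; rewrite (negbTE (none i)).
    by rewrite sub0r sqrrN !PoszM expr2.
  by rewrite -(big_morph Posz PoszD (erefl (Posz 0))) sum_nat_const.
by move: low; rewrite var; move: (#|Z| * _) (N * _) (\sum_A _) => x y z; lia.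
Qed.

Definition graph_space k d (M : 'M['F_2]_(k, d)) : {set 'rV['F_2]_(k + d)} :=
  [set row_mx x (x *m M)%R | x : 'rV['F_2]_k].

Definition kernel_size k d (D : 'M['F_2]_(k, d)) : nat :=
  #|[set x : 'rV['F_2]_k | (x *m D)%R == 0%R]|.

Lemma card_graph_space k d (M : 'M['F_2]_(k, d)) : #|graph_space M| = 2 ^ k.
Proof.
rewrite card_imset ?card_mx ?card_Fp ?mul1n // => x y /eq_row_mx[]; done.
Qed.

Lemma graph_space0 k d (M : 'M['F_2]_(k, d)) : 0%R \in graph_space M.
Proof. by apply/imsetP; exists 0%R; rewrite // mul0mx row_mx0. Qed.

Lemma graph_spaceD k d (M : 'M['F_2]_(k, d)) u v :
  u \in graph_space M -> v \in graph_space M -> (u + v)%R \in graph_space M.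
Proof.
case/imsetP=> x _ -> /imsetP[y _ ->]; apply/imsetP; exists (x + y)%R => //.
by rewrite mulmxDl add_row_mx.
Qed.

Lemma card_graph_spaceI k d (M M' : 'M['F_2]_(k, d)) :
  #|graph_space M :&: graph_space M'| = kernel_size (M - M')%R.
Proof.
rewrite /kernel_size -(card_imset (f := fun x => row_mx x (x *m M)%R)); last first.
  by move=> x y /eq_row_mx[].
congr #|pred_of_set _|; apply/setP=> u; apply/setIP/imsetP.
  case=> /imsetP[x _ ->] /imsetP[y _ /eq_row_mx[<- e]].
  by exists x; rewrite // inE mulmxBr e subrr.
case=> x; rewrite inE mulmxBr subr_eq0 => /eqP e ->.
by split; apply/imsetP; exists x; rewrite // e.
Qed.

Lemma kernel_size_le k d (D : 'M['F_2]_(k, d)) : kernel_size D <= 2 ^ (k - \rank D).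
Proof.
rewrite -mxrank_ker /kernel_size.
have -> : 2 ^ \rank (kermx D) = #|[set: 'rV['F_2]_(\rank (kermx D))]|.
  by rewrite cardsT card_mx mul1n card_Fp.
apply: leq_trans (leq_imset_card (fun y => (y *m row_base (kermx D))%R) _).
apply/subset_leq_card/subsetP=> x; rewrite inE => /eqP/sub_kermxP.
rewrite -(eq_row_base (kermx D)) => /submxP[y ->].
by apply/imsetP; exists y.
Qed.

(** A matrix of rank [rho] factors through dimension [rho]. *)
Lemma card_rank k d rho :
  #|[set D : 'M['F_2]_(k, d) | \rank D == rho]| <= 2 ^ (rho * (k + d)).
Proof.
have -> : 2 ^ (rho * (k + d)) = #|[set: 'M['F_2]_(k, rho) * 'M['F_2]_(rho, d)]|.
  by rewrite cardsT card_prod !card_mx !card_Fp // -expnD mulnDr [rho * k]mulnC.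
apply: leq_trans (leq_imset_card (fun p => (p.1 *m p.2)%R) _).
apply/subset_leq_card/subsetP=> D; rewrite inE => /eqP <-.
by apply/imsetP; exists (col_base D, row_base D); rewrite ?inE //= mulmx_base.
Qed.

Lemma power_slope k e : 0 < e -> e <= k -> 2 ^ e * k <= e * 2 ^ k.
Proof.
move=> e0 ek; rewrite -(subnKC ek); move: (k - e) => j; elim: j => [|j IH].
  by rewrite addn0 mulnC.
rewrite addnS expnS mulnS [leqRHS]mulnCA mul2n -addnn leq_add // (leq_trans _ IH) //.
by rewrite leq_pmulr // addn_gt0 e0.
Qed.

(** Group by rank [k - e]. Full rank contributes at most [2 ^ (k * d)]; each [e > 0] contributes at
    most [2 ^ (k * d - k)], because [2 ^ e / e] is largest at [e = k] and so
    [2 ^ e <= e * (d - k ^ 2)]. *)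
Lemma sum_kernel k d : 0 < k -> 2 ^ k <= k * (d - k ^ 2) -> k ^ 2 <= d ->
  2 ^ k * \sum_(D : 'M['F_2]_(k, d)) 2 ^ (kernel_size D).-1 <= (2 ^ k + k) * 2 ^ (k * d).
Proof.
move=> k0 hk dk.
pose F rho := \sum_(D : 'M['F_2]_(k, d) | \rank D == rho) 2 ^ (kernel_size D).-1.
have -> : \sum_(D : 'M['F_2]_(k, d)) 2 ^ (kernel_size D).-1 = \sum_(rho < k.+1) F rho.
  rewrite (partition_big (fun D : 'M_(k, d) => inord (\rank D) : 'I_k.+1) xpredT) //=.
  apply: eq_bigr => rho _; apply: eq_bigl => D.
  by rewrite -val_eqE /= inordK // ltnS rank_leq_row.
rewrite big_ord_recr /= mulnDr mulnDl addnC; apply: leq_add.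
  rewrite leq_mul2l; apply/orP; right.
  apply: (@leq_trans (\sum_(D : 'M['F_2]_(k, d) | \rank D == k) 1)).
    apply: leq_sum => D /eqP rD; have := kernel_size_le D; rewrite rD subnn.
    by case: (kernel_size D) => [|[|]].
  by rewrite sum1dep_card (leq_trans (max_card _)) // card_mx card_Fp.
rewrite big_distrr /=; apply: (@leq_trans (\sum_(rho < k) 2 ^ (k * d))); last first.
  by rewrite sum_nat_const card_ord.
apply: leq_sum => rho _; set e := k - rho.
have rk := ltn_ord rho; have e0 : 0 < e by rewrite subn_gt0.
have ek : e <= k by apply: leq_subr.
apply: (@leq_trans (2 ^ k * (2 ^ (rho * (k + d)) * 2 ^ (2 ^ e).-1))).
  rewrite leq_mul2l; apply/orP; right.
  apply: (@leq_trans (\sum_(D : 'M['F_2]_(k, d) | \rank D == rho) 2 ^ (2 ^ e).-1)).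
    apply: leq_sum => D /eqP rD; rewrite leq_exp2l // -!subn1 leq_sub2r //.
    by rewrite /e -rD kernel_size_le.
  rewrite sum_nat_const leq_mul2r; apply/orP; right.
  by apply: leq_trans (card_rank k d rho); rewrite cardsE.
rewrite -!expnD leq_exp2l //.
have slope : 2 ^ e <= e * (d - k ^ 2).
  rewrite -(leq_pmul2r k0) (leq_trans (power_slope e0 ek)) // -mulnA leq_mul2l.
  by rewrite [_ * k]mulnC hk orbT.
have p2 : 0 < 2 ^ e by rewrite expn_gt0.
have kE : k = rho + e by rewrite /e addnC subnK // ltnW.
have h1 : k ^ 2 <= e * k ^ 2 by rewrite leq_pmull.
have h3 : k * d = rho * d + e * d by rewrite {1}kE mulnDl.
have h4 : rho * k + k <= k ^ 2.
  by rewrite addnC -mulSn expnS expn1 leq_mul2r rk orbT.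
have h5 : e * d = e * (d - k ^ 2) + e * k ^ 2 by rewrite -mulnDr subnK.
rewrite mulnDr h3 h5; move: slope h1 h4 p2.
move: (2 ^ e) (e * (d - k ^ 2)) (e * k ^ 2) (k ^ 2) (rho * k) (rho * d).
by clear; move=> *; lia.
Qed.

(** A pair of graphs enters the second moment only through the difference of its matrices, so
    [sum_kernel] bounds the relative variance by [k / 2 ^ k]. *)
Lemma card_no_subspace k d : 0 < k -> 2 ^ k <= k * (d - k ^ 2) -> k ^ 2 <= d ->
  #|[set A : {set 'rV['F_2]_(k + d)} | [forall M : 'M['F_2]_(k, d),
      ~~ (graph_space M :\ 0%R \subset A)]]| * 2 ^ k <= k * 2 ^ #|{: 'rV['F_2]_(k + d)}|.
Proof.
move=> k0 hk dk.
have Wa (M : 'M['F_2]_(k, d)) : #|graph_space M :\ 0%R| = (2 ^ k).-1.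
  by have := cardsD1 0%R (graph_space M); rewrite graph_space0 card_graph_space => ->.
have := second_moment Wa; set z := #|[set A | _]|; set N := 2 ^ #|_|.
have -> : \sum_(i : 'M['F_2]_(k, d)) \sum_(j : 'M['F_2]_(k, d))
      2 ^ #|(graph_space i :\ 0%R) :&: (graph_space j :\ 0%R)| =
    #|{: 'M['F_2]_(k, d)}| * \sum_(D : 'M['F_2]_(k, d)) 2 ^ (kernel_size D).-1.
  rewrite -sum_nat_const; apply: eq_bigr => i _.
  rewrite (reindex_inj (addrI i)) /=.
  apply: eq_bigr => D _; congr (2 ^ _).
  rewrite -setDIl; set H := _ :&: _.
  have H0 : 0%R \in H by rewrite inE !graph_space0.
  have := cardsD1 0%R H; rewrite H0 card_graph_spaceI.
  suff -> : (i - (i + D) = D)%R by move=> ->.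
  by apply/eqP; rewrite opprD addrA subrr add0r eq_sym -addr_eq0 mx_char2.
have -> : #|{: 'M['F_2]_(k, d)}| = 2 ^ (k * d) by rewrite card_mx card_Fp.
set L := 2 ^ (k * d) => h; have := sum_kernel k0 hk dk; rewrite -/L => h2.
have Lpos : 0 < L ^ 2 by rewrite !expn_gt0.
rewrite -(leq_pmul2r Lpos) -(leq_add2r (2 ^ k * (N * L ^ 2))).
have -> : z * 2 ^ k * L ^ 2 + 2 ^ k * (N * L ^ 2) = 2 ^ k * (z * L ^ 2 + N * L ^ 2).
  by rewrite mulnDr; congr (_ + _); rewrite mulnCA mulnA.
apply: leq_trans (leq_mul (leqnn _) h) _.
have -> : k * N * L ^ 2 + 2 ^ k * (N * L ^ 2) = N * L * ((2 ^ k + k) * L).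
  by rewrite expnS expn1; move: (2 ^ k) => y; clear; lia.
by rewrite mulnCA -mulnA !leq_mul2l mulnCA leq_mul2l h2 !orbT.
Qed.

(** * The clique number *)

Lemma omega_sumset n (A : {set 'rV['F_2]_n}) m : 0 < m -> m <= omega A ->
  exists S : {set 'rV['F_2]_n}, #|S| = m /\ (S :+: S) :\ 0%R \subset A.
Proof.
move=> m0; rewrite leqNgt => big.
have /existsP[S /andP[clS Sm]] : [exists S : {set 'rV['F_2]_n},
    is_clique (cayley_sum_graph A) S && (m <= #|S|)].
  apply: contraNT big => /existsPn no.
  rewrite -(prednK m0) ltnS; apply/bigmax_leqP => S clS.
  by have := no S; rewrite clS /= -ltnNge -{1}(prednK m0) ltnS.
have [S' [sS' cS']] := subset_of_card Sm.
exists S'; split=> //; apply/subsetP=> z /setD1P[xy0 /sumsetP[x [y [Sx Sy e]]]].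
rewrite e in xy0 *.
move/forall_inP/(_ x (subsetP sS' x Sx))/forall_inP/(_ y (subsetP sS' y Sy)): clS.
have xy : x != y by apply: contraNneq xy0 => ->; rewrite mx_char2.
by rewrite /cayley_sum_graph xy.
Qed.

Lemma graph_space_omega k d (A : {set 'rV['F_2]_(k + d)}) (M : 'M['F_2]_(k, d)) :
  graph_space M :\ 0%R \subset A -> 2 ^ k <= omega A.
Proof.
move=> sA; rewrite -(card_graph_space M); apply: leq_bigmax_cond.
apply/forall_inP=> x Mx; apply/forall_inP=> y My; apply/implyP=> xy.
rewrite /cayley_sum_graph xy /=; apply: (subsetP sA); rewrite !inE graph_spaceD // andbT.
by apply: contraNneq xy => /eqP; rewrite addr_eq0 => /eqP ->; rewrite eq_sym -addr_eq0 mx_char2.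
Qed.

(** Failure below the window has probability at most [k / 2 ^ k] by the second moment, and above it
    at most [1 / 2 ^ k] by the union bounds; the sum is at most [1 / k.+1]. *)
Lemma omega_window_count n k l g c b m :
  k = 128 * l -> b = 2 ^ (8 * l) -> 0 < l -> 0 < g -> 134 <= c -> 2 * k <= n ->
  m <= 2 * 2 ^ k -> g.+1 * 2 ^ k <= g * m ->
  g.+1 * (n * k) <= g * (2 * 2 ^ k) -> 2 ^ k + k ^ 3 + k ^ 2 <= n * k ->
  1000 * g * k ^ 4 <= b -> 16 * g * 2 ^ (6 * c) <= k ->
  #|[set A : {set 'rV['F_2]_n} | ~~ ((2 ^ k <= omega A) && (omega A < m))]| * k.+1 <=
  2 ^ #|{: 'rV['F_2]_n}|.
Proof.
move=> kl bl l0 g0 c134 kn2 mle mge gnk nkge bbig klarge.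
have k1 : 128 <= k by clear - kl l0; lia.
have kn : k <= n by apply: leq_trans kn2; rewrite leq_pmull.
have nkge' : 2 ^ k <= 2 * (n * k).
  by move: nkge; move: (2 ^ k) (k ^ 3) (k ^ 2) (n * k) => x y z t; clear; lia.
have nk : n * k <= 2 * 2 ^ k.
  by rewrite -(leq_pmul2l g0); apply: leq_trans gnk; rewrite leq_mul2r leqnSn orbT.
have mpos : 0 < m.
  have : 0 < g * m by apply: leq_trans mge; rewrite muln_gt0 expn_gt0.
  by rewrite muln_gt0 => /andP[].
have n2k : n.+1 <= 2 ^ k.
  have : n * 128 <= n * k by rewrite leq_mul2l k1 orbT.
  have : 2 <= 2 ^ k by rewrite -{1}(expn1 2) leq_exp2l // (leq_trans _ k1).
  by move: nk; move: (2 ^ k) (n * k) => y z; clear; lia.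
have ksq : k.+1 * k.+1 <= 2 ^ k.
  have : 1000 * g * k ^ 4 <= 2 ^ k by apply: leq_trans bbig _; rewrite bl leq_exp2l // kl; clear; lia.
  apply: leq_trans; apply: leq_trans (_ : 4 * k ^ 4 <= _); last first.
    by rewrite leq_mul2r (leq_trans _ (leq_pmulr 1000 g0)) ?orbT.
  have : k.+1 <= 2 * k by clear - k1; lia.
  move=> h; apply: leq_trans (leq_mul h h) _.
  rewrite mulnACA leq_mul2l /= -[k * k]/(k ^ 2) leq_pexp2l // (leq_trans _ k1) //.
set N := 2 ^ #|_|; set Z := [set A | _].
pose Z1 := [set A : {set 'rV['F_2]_n} | omega A < 2 ^ k].
pose Z2 := [set A : {set 'rV['F_2]_n} | m <= omega A].
have sZ : #|Z| <= #|Z1| + #|Z2|.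
  apply: leq_trans (leq_card_setU _ _); apply/subset_leq_card/subsetP=> A.
  by rewrite !inE negb_and -ltnNge -leqNgt.
have c2 : #|Z2| * 2 ^ k <= N.
  have h := @card_sumset_event n k l g c b m kl bl l0 g0 c134 kn mle mge gnk nkge' bbig klarge.
  have sub : #|Z2| <= #|[set A : {set 'rV['F_2]_n} | [exists S : {set _},
      (#|S| == m) && ((S :+: S) :\ 0%R \subset A)]]|.
    apply/subset_leq_card/subsetP=> A; rewrite !inE => /(omega_sumset mpos)[S [Sm SA]].
    by apply/existsP; exists S; rewrite Sm eqxx.
  have {}h := leq_trans (leq_mul sub (leqnn _)) h.
  have e : 2 ^ (4 * k).-1 = 2 ^ (2 * k + 4) * 2 ^ (2 * k - 5).
    by rewrite -expnD; congr (2 ^ _); clear - k1; lia.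
  have nn : n.+1 * (6 * n).+2 <= 2 ^ (2 * k + 4).
    apply: (@leq_trans (2 ^ k * (2 ^ k * 2 ^ 4))); last by rewrite -!expnD addnA addnn -mul2n.
    by rewrite leq_mul // mulnC; move: n2k; move: (2 ^ k) => y; clear; lia.
  have {}h := leq_trans h (leq_mul nn (leqnn _)).
  move: h; rewrite e mulnCA leq_pmul2l ?expn_gt0 // => h; apply: leq_trans h.
  by rewrite leq_mul2l leq_exp2l // -/N; apply/orP; right; clear - k1; lia.
have c1 : #|Z1| * 2 ^ k <= k * N.
  (* With [n = k + d], the hypothesis on [n * k] amounts to [2 ^ k <= k * (d - k ^ 2)]. *)
  rewrite /Z1 /N; move: nkge kn2; rewrite -(subnKC kn); move: (n - k) => d nkge kd.
  have kp : 0 < k by apply: leq_trans k1.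
  have e : (k + d) * k = k ^ 2 + k * d by rewrite mulnDl [d * k]mulnC.
  have hd : k ^ 2 <= d.
    rewrite -(leq_pmul2l kp) -expnS; move: nkge; rewrite e.
    by move: (2 ^ k) (k ^ 3) (k ^ 2) (k * d) => x y z t; clear; lia.
  have hk : 2 ^ k <= k * (d - k ^ 2).
    move: nkge; rewrite e mulnBr -expnS.
    by move: (2 ^ k) (k ^ 3) (k ^ 2) (k * d) => x y z t; clear; lia.
  apply: leq_trans (card_no_subspace kp hk hd); rewrite leq_mul2r; apply/orP; right.
  apply/subset_leq_card/subsetP=> A; rewrite !inE => lt; apply/forallP=> M.
  by apply: contraL lt; rewrite -leqNgt => /graph_space_omega.
have p2 : 0 < 2 ^ k by rewrite expn_gt0.
rewrite -(leq_pmul2r p2).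
apply: (@leq_trans ((#|Z1| * 2 ^ k + #|Z2| * 2 ^ k) * k.+1)).
  by rewrite -mulnDl mulnAC leq_mul2r leq_mul2r sZ !orbT.
apply: (@leq_trans ((k * N + N) * k.+1)); first by rewrite leq_mul2r leq_add ?orbT.
by rewrite addnC -mulSn mulnAC mulnC leq_mul2l ksq orbT.
Qed.

(** * Choice of the parameters *)

Lemma exp_dominates_poly A p : exists l0, forall l, l0 <= l -> A * l ^ p <= 2 ^ l.
Proof.
pose B := A * p.+1 ^ p; exists (p.+1 * B.+1) => l lB.
set t := l %/ p.+1.
have Bt : B <= 2 ^ t.
  apply: (@leq_trans t); last by rewrite ltnW // ltn_expl.
  by rewrite /t leq_divRL // mulnC (leq_trans _ lB) // leq_mul2l leqnSn orbT.
have lt : l <= p.+1 * 2 ^ t.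
  rewrite {1}(divn_eq l p.+1) -/t mulnC.
  have : l %% p.+1 < p.+1 by rewrite ltn_mod.
  have : t < 2 ^ t by rewrite ltn_expl.
  move: (l %% _) (2 ^ t) => r y; clear; nia.
apply: (@leq_trans (A * (p.+1 * 2 ^ t) ^ p)).
  rewrite leq_mul2l; apply/orP; right.
  by case: (posnP p) => [->//|p0]; rewrite leq_exp2r.
rewrite expnMn mulnA -/B; apply: leq_trans (leq_mul Bt (leqnn _)) _.
by rewrite -expnM -expnD leq_exp2l // -mulnS leq_divM.
Qed.

(** Any [l] past all thresholds works: [k] outgrows the fixed [g], [c] and [i], while [k ^ 4] stays
    small against [b]. *)
Lemma asymptotic_regime g c i : 0 < g -> exists k l b,
  [/\ k = 128 * l, b = 2 ^ (8 * l), 0 < l & i <= k] /\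
  [/\ 1000 * g * k ^ 4 <= b, 16 * g * 2 ^ (6 * c) <= k, (2 * k) ^ (4 * g) <= 2 ^ k &
    1000 * g * k ^ 4 <= 2 ^ k].
Proof.
move=> g0.
have [l1 h1] := exp_dominates_poly (1000 * g * 128 ^ 4) 4.
have [l2 h2] := exp_dominates_poly (2 ^ (4 * g)) (4 * g).
set K := 16 * g * 2 ^ (6 * c).
pose l := (i + K + l1 + l2).+1.
have le x : x <= i + K + l1 + l2 -> x <= 128 * l.
  by rewrite /l => h; apply: leq_trans h _; apply: leq_trans (leqnSn _) _; rewrite leq_pmull.
have bnd : 1000 * g * (128 * l) ^ 4 <= 2 ^ (8 * l).
  rewrite expnMn mulnA; apply: leq_trans (h1 l _) _; last by rewrite leq_exp2l // leq_pmull.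
  by rewrite /l; clear; lia.
exists (128 * l), l, (2 ^ (8 * l)); split; first by split=> //; apply: le; clear; lia.
split=> //.
- by apply: le; rewrite -/K; clear; lia.
- by rewrite expnMn; apply: h2; apply: le; clear; lia.
- by apply: leq_trans bnd _; rewrite leq_exp2l // leq_mul2r orbT.
Qed.

(** Integer form of [(1 - 1 / (4 * g)) * k <= log2 n]. *)
Lemma power_lower_bound n k g : 0 < g -> 2 ^ k <= n * (2 * k) -> (2 * k) ^ (4 * g) <= 2 ^ k ->
  2 ^ ((4 * g).-1 * k) <= n ^ (4 * g).
Proof.
move=> g0 nk hk; rewrite -(leq_pmul2r (_ : 0 < 2 ^ k)) ?expn_gt0 // -expnD.
have -> : (4 * g).-1 * k + k = k * (4 * g).
  by rewrite addnC -mulSn prednK ?muln_gt0 // mulnC.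
rewrite expnM; apply: leq_trans (_ : (n * (2 * k)) ^ (4 * g) <= _).
  by rewrite leq_exp2r ?muln_gt0.
by rewrite expnMn leq_mul2l hk orbT.
Qed.

(* The order [n] for which a subspace of size [2 ^ k] is only half of what the union
   bound excludes: [n * k] is close to [2 ^ k.+1] from below. *)
Lemma sparse_order g k : 1 < g -> 128 <= k -> 1000 * g * k ^ 4 <= 2 ^ k ->
  exists n, [/\ g.+1 * (n * k) <= g * (2 * 2 ^ k), g * (2 * 2 ^ k) <= g.+1 * (n * k + k),
    2 ^ k + k ^ 3 + k ^ 2 <= n * k, 2 * k <= n & n <= 2 ^ k].
Proof.
move=> g1 k1 kbig.
have kpos : 0 < k by apply: leq_trans k1.
have gk : 0 < g.+1 * k by rewrite muln_gt0.
set q := 2 ^ k in kbig *.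
pose n := (g * (2 * q)) %/ (g.+1 * k); exists n.
have up : g.+1 * (n * k) <= g * (2 * q).
  by have := leq_divM (g * (2 * q)) (g.+1 * k); rewrite -/n mulnCA.
have low : g * (2 * q) <= g.+1 * (n * k + k).
  have := ltn_ceil (g * (2 * q)) gk; rewrite -/n => /ltnW; rewrite mulSn; clear; nia.
have q3 : 4 * q <= 3 * (n * k + k).
  rewrite -(leq_pmul2l (ltn0Sn g)); move: low g1; move: (n * k + k) => y; clear; nia.
have k34 : k ^ 3 <= k ^ 4 by rewrite leq_pexp2l.
have k24 : k ^ 2 <= k ^ 4 by rewrite leq_pexp2l.
have k14 : k <= k ^ 4 by rewrite -{1}(expn1 k) leq_pexp2l.
have kq : 1000 * k ^ 4 <= q.
  by apply: leq_trans kbig; rewrite leq_mul2r leq_pmulr ?orbT // ltnW.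
have ge : q + k ^ 3 + k ^ 2 <= n * k.
  by move: q3 kq k34 k24 k14; move: (n * k) (k ^ 4) (k ^ 3) (k ^ 2) => x y z t; clear; lia.
have n2 : 2 * k <= n.
  rewrite -(leq_pmul2r kpos) -mulnA; apply: leq_trans ge; rewrite -[k * k]/(k ^ 2).
  by move: kq k24; move: (k ^ 4) (k ^ 3) (k ^ 2) => y z t; clear; lia.
split=> //.
have : n * 128 <= n * k by rewrite leq_mul2l k1 orbT.
have : n * k <= 2 * q.
  by rewrite -(leq_pmul2l (ltnW g1)); apply: leq_trans up; rewrite leq_mul2r leqnSn orbT.
by move: (n * k) => y; clear; lia.
Qed.

(* The order [n] for which subspaces of size [2 ^ k] barely exist: [n * k] exceeds
   [2 ^ k] by a lower order term. *)
Lemma dense_order g k : 1 < g -> 128 <= k -> 1000 * g * k ^ 4 <= 2 ^ k ->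
  exists n, [/\ g.+1 * (n * k) <= g * (2 * 2 ^ k), n * k < 2 ^ k + 6 * n,
    2 ^ k + k ^ 3 + k ^ 2 <= n * k, 2 * k <= n & n <= 2 ^ (k - 6)].
Proof.
move=> g1 k1 kbig.
have kpos : 0 < k by apply: leq_trans k1.
set q := 2 ^ k in kbig *.
pose u := q %/ k; pose n := k + k ^ 2 + u.+1; exists n.
have k34 : k * k ^ 3 = k ^ 4 by rewrite -expnS.
have k24 : k ^ 2 <= k ^ 3 by rewrite leq_pexp2l.
have k14 : k <= k ^ 3 by rewrite -{1}(expn1 k) leq_pexp2l.
have k44 : k ^ 3 <= k ^ 4 by rewrite leq_pexp2l.
have kq : 1000 * k ^ 4 <= q.
  by apply: leq_trans kbig; rewrite leq_mul2r leq_pmulr ?orbT // ltnW.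
have uk : u * k <= q by apply: leq_divM.
have uk2 : q < u.+1 * k by apply: ltn_ceil.
have nk : n * k = k ^ 2 + k ^ 3 + u.+1 * k by rewrite /n !mulnDl -expnSr.
have nk2 : n * k <= q + k + k ^ 2 + k ^ 3 by rewrite nk mulSn; move: uk; clear; lia.
have n3 : 1000 * k ^ 3 <= n.
  rewrite -(leq_pmul2l kpos) mulnCA k34 (leq_trans kq) // mulnC nk.
  by apply: leq_trans (ltnW uk2) (leq_addl _ _).
have q43 : 3 * (n * k) <= 4 * q.
  by move: nk2 kq k24 k14 k44; move: (n * k) (k ^ 4) (k ^ 3) (k ^ 2) => x y z t; clear; lia.
split.
- move: q43 g1; move: (n * k) => y; clear; nia.
- by move: nk2 n3 k24 k14 kpos; move: (n * k) (k ^ 3) (k ^ 2) => x y z; clear; lia.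
- by rewrite nk; move: uk2; move: (u.+1 * k) (k ^ 3) (k ^ 2) => x y z; clear; lia.
- by apply: leq_trans n3; move: k14; move: (k ^ 3) => y; clear; lia.
- have : n * 128 <= n * k by rewrite leq_mul2l k1 orbT.
  have -> : 2 ^ (k - 6) = 2 ^ (k - 6) * 2 ^ 6 %/ 2 ^ 6 by rewrite mulnK.
  rewrite -expnD subnK ?(leq_trans _ k1) // leq_divRL // -/q.
  by move: q43; move: (n * k) => y; clear; lia.
Qed.

From mathcomp Require Import all_classical all_reals all_analysis.
Import Order.TTheory GRing.Theory Num.Theory numFieldNormedType.Exports.
Local Open Scope ring_scope.

(** * Concentration of the clique number along subsequences *)

Lemma random_subset_prob_half (R : realType) (T : finType) (E : pred {set T}) :
  random_subset_prob (2^-1 : R) E = #|finset E|%:R / (2 ^ #|T|)%:R.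
Proof.
rewrite /random_subset_prob (eq_bigr (fun _ => ((2 ^ #|T|)%:R)^-1)); last first.
  move=> A _; rewrite (eq_bigr (fun _ => 2^-1)); last first.
    by move=> x _; case: ifP => // _; field.
  by rewrite prodr_const natrX exprVn.
rewrite (eq_bigl (fun A => A \in finset E)); last by move=> A; rewrite finset.inE.
by rewrite sumr_const mulr_natl.
Qed.

Lemma prob_omega_window (R : realType) (c C : R) n k m :
  (#|finset (fun A : {set 'rV['F_2]_n} => ~~ ((2 ^ k <= omega A) && (omega A < m)))| * k.+1 <=
    2 ^ #|{: 'rV['F_2]_n}|)%N ->
  c * n%:R * log2 n%:R < (2 ^ k)%:R -> m%:R <= C * n%:R * log2 n%:R ->
  1 - k.+1%:R^-1 <= prob_omega_between c C n.
Proof.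
move=> bad lo hi; rewrite /prob_omega_between random_subset_prob_half.
set E := (fun A => _ && _); set N := (2 ^ _)%N.
have N0 : 0 < N%:R :> R by rewrite ltr0n expn_gt0.
have cE : (N <= #|finset E| + #|finset (fun A : {set 'rV['F_2]_n} =>
    ~~ ((2 ^ k <= omega A) && (omega A < m))%N)|)%N.
  have -> : N = #|(finset.setT : {set {set 'rV['F_2]_n}})|.
    by rewrite -powersetT card_powerset cardsT.
  apply: leq_trans (leq_card_setU _ _); apply/subset_leq_card/fintype.subsetP=> A _.
  rewrite !finset.inE -implyNb; apply/implyP; apply: contra => /andP[h1 h2].
  rewrite /E; apply/andP; split.
    by apply: lt_le_trans lo _; rewrite ler_nat.
  by apply: lt_le_trans hi; rewrite ltr_nat.
rewrite ler_pdivlMr // mulrBl mul1r lerBlDr.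
set b := #|_| in bad; set e := #|finset E| in cE *.
have hb : b%:R <= k.+1%:R^-1 * N%:R :> R.
  by rewrite ler_pdivlMl // mulrC -natrM ler_nat.
apply: le_trans (_ : (e + b)%:R <= _); first by rewrite ler_nat.
by rewrite natrD lerD2l.
Qed.

Lemma log2_upper (R : realType) n p q : (0 < n)%N -> (n ^ p <= 2 ^ q)%N ->
  p%:R * log2 n%:R <= q%:R :> R.
Proof.
move=> n0 h; have l2 : 0 < ln 2 :> R by apply: ln_gt0; lra.
rewrite /log2 mulrA ler_pdivrMr // !mulr_natl -!lnXn ?ltr0n //.
by rewrite ler_ln ?posrE ?exprn_gt0 ?ltr0n // -!natrX ler_nat.
Qed.

Lemma log2_lower (R : realType) n p q : (0 < n)%N -> (2 ^ q <= n ^ p)%N ->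
  q%:R <= p%:R * log2 n%:R :> R.
Proof.
move=> n0 h; have l2 : 0 < ln 2 :> R by apply: ln_gt0; lra.
rewrite /log2 mulrA ler_pdivlMr // !mulr_natl -!lnXn ?ltr0n //.
by rewrite ler_ln ?posrE ?exprn_gt0 ?ltr0n // -!natrX ler_nat.
Qed.

Lemma prob_omega_disjoint (R : realType) (c C c' C' : R) n :
  (forall x, ~~ [&& c * n%:R * log2 n%:R < x, x < C * n%:R * log2 n%:R,
     c' * n%:R * log2 n%:R < x & x < C' * n%:R * log2 n%:R]) ->
  prob_omega_between c C n + prob_omega_between c' C' n <= 1.
Proof.
move=> disj; rewrite /prob_omega_between !random_subset_prob_half.
set E := (fun A => _ && _); set E' := (fun A => _ && _); set N := (2 ^ _)%N.
have N0 : 0 < N%:R :> R by rewrite ltr0n expn_gt0.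
rewrite -mulrDl ler_pdivrMr // mul1r -natrD ler_nat.
have -> : N = #|(finset.setT : {set {set 'rV['F_2]_n}})|.
  by rewrite -powersetT card_powerset cardsT.
have I0 : finset E :&: finset E' = finset.set0.
  apply/finset.setP=> A; rewrite !finset.inE; apply/negP=> /andP[/andP[h1 h2] /andP[h3 h4]].
  by have := disj (omega A)%:R; rewrite h1 h2 h3 h4.
rewrite -(cardsUI (finset E)) I0 cards0 addn0.
by apply/subset_leq_card/fintype.subsetP=> A _; rewrite finset.inE.
Qed.

Lemma prob_omega_between_le1 (R : realType) (c C : R) n : prob_omega_between c C n <= 1.
Proof.
apply: le_trans (@prob_omega_disjoint R c C 0 0 n _); last first.
  by move=> x; rewrite !mul0r; apply/negP=> /and4P[_ _ /lt_trans h /h]; rewrite ltxx.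
by rewrite lerDl /prob_omega_between random_subset_prob_half divr_ge0.
Qed.

(** Iterate a choice function [f] from 0: [f i > i] makes the orbit increasing, and its [i]-th term
    is at least [i], which controls the error. *)
Lemma fast_subsequence (R : realType) (P : nat -> R) : (forall n, P n <= 1) ->
  (forall i, exists n, (i < n)%N /\ 1 - i.+1%:R^-1 <= P n) ->
  exists u : nat -> nat, [/\ increasing_seq u, forall i, (0 < u i)%N &
    ((fun i => P (u i)) @ \oo --> (1 : R))%classic].
Proof.
move=> P1 /choice[f fP].
have geS i : (i <= iter i f 0)%N.
  by elim: i => // i IH; rewrite (leq_ltn_trans IH) // iterS; case: (fP (iter i f 0%N)).
exists (fun i => iter i.+1 f 0%N); split.
- by apply/increasing_seqP => n; rewrite [ltRHS]iterS; case: (fP (iter n.+1 f 0%N)).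
- by move=> i; apply: leq_trans (geS i.+1).
- apply: (@squeeze_cvgr _ _ _ _ (fun i => 1 - i.+1%:R^-1) (fun=> 1)); last exact: cvg_cst.
    apply: nearW => i; rewrite P1 andbT iterS.
    case: (fP (iter i f 0%N)) => _; apply: le_trans.
    by rewrite lerD2l lerN2 lef_pV2 ?posrE ?ltr0n // ler_nat ltnS.
  rewrite -[X in (_ --> X)%classic]subr0; apply: cvgB; first exact: cvg_cst.
  exact: cvg_harmonic.
Qed.

(** A power of 2 makes [2 ^ k / g] an integer, and [4 / g <= eps] is the slack that the window
    estimates spend. *)
Lemma large_power2 (R : realType) (eps : R) : 0 < eps ->
  exists a, (0 < a)%N /\ 4 <= eps * (2 ^ a)%:R.
Proof.
move=> e0; have [N hN] : exists N : nat, 4 / eps < N%:R.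
  by exists (Num.bound (4 / eps)); apply: archi_boundP; rewrite divr_ge0 // ltW.
exists N.+1; split=> //; rewrite mulrC -ler_pdivrMr //; apply: le_trans (ltW hN) _.
by rewrite ler_nat ltnW // (ltn_trans _ (ltn_expl _ _)).
Qed.

Lemma log2_lower_fraction (R : realType) n k g : (0 < g)%N -> (0 < n)%N ->
  (2 ^ k <= n * (2 * k))%N -> ((2 * k) ^ (4 * g) <= 2 ^ k)%N ->
  (1 - g%:R^-1 / 4) * k%:R <= log2 n%:R :> R.
Proof.
move=> g0 n0 h1 h2; have G0 : 0 < g%:R :> R by rewrite ltr0n.
have := @log2_lower R _ _ _ n0 (power_lower_bound g0 h1 h2).
rewrite natrM -subn1 natrB ?muln_gt0 // natrM => h.
rewrite -(ler_pM2l (_ : 0 < 4 * g%:R)); last by rewrite mulr_gt0.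
apply: le_trans h; rewrite le_eqVlt; apply/orP; left; apply/eqP.
by field; rewrite gt_eqF.
Qed.

(** * Arithmetic of the two windows *)

Lemma ler_ratio_l (R : realFieldType) (G x y : R) : 0 < G ->
  ((G + 1) * x <= G * y) = ((1 + G^-1) * x <= y).
Proof. by move=> G0; rewrite -[RHS](ler_pM2l G0) mulrA mulrDr mulr1 mulfV // gt_eqF. Qed.

Lemma ler_ratio_r (R : realFieldType) (G x y : R) : 0 < G ->
  (G * y <= (G + 1) * x) = (y <= (1 + G^-1) * x).
Proof. by move=> G0; rewrite -[RHS](ler_pM2l G0) mulrA mulrDr mulr1 mulfV // gt_eqF. Qed.

(** Used with [d = 1 / g], [q = 2 ^ k], [x = n * k] and [w = n * log2 n]. Up to the error
    [k <= d * q / 1000], [x] is at least [2 * (1 - d) * q], whence [201 / 100]; the slack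
    [4 * d <= eps] outweighs all losses. *)
Lemma half_window_arith (R : realFieldType) (d eps q x k w : R) :
  0 < d -> d <= 2^-1 -> 4 * d <= eps -> 0 < q -> 0 <= k -> 0 < x ->
  2 * q <= (1 + d) * (x + k) -> 1000 * k <= d * q -> (1 - d / 4) * x <= w ->
  (1 + d) * q <= (2^-1 + eps) * w.
Proof.
move=> d0 d2 de q0 k0 x0 low kq xw.
have y1 : (1 - d) * (2 * q) <= x + k.
  have h : (1 - d) * (2 * q) <= (1 - d) * ((1 + d) * (x + k)) by rewrite ler_wpM2l //; lra.
  apply: le_trans h _; rewrite mulrA ler_piMl //; first by lra.
  nra.
have y2 : (2 - 201 / 100 * d) * q <= x by lra.
have p1 : 0 <= 1 - d / 4 by lra.
have p2 : 0 <= (2 - 201 / 100 * d) * q by rewrite mulr_ge0 // ?ltW //; lra.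
have y3 : (1 - d / 4) * ((2 - 201 / 100 * d) * q) <= w.
  by apply: le_trans xw; rewrite ler_wpM2l.
have y4 : (2^-1 + 4 * d) * ((1 - d / 4) * ((2 - 201 / 100 * d) * q)) <= (2^-1 + eps) * w.
  apply: ler_pM => //; last by rewrite lerD2l.
    by lra.
  by rewrite mulr_ge0.
apply: le_trans y4; rewrite !mulrA ler_pM2r //; nra.
Qed.

Lemma full_window_arith (R : realFieldType) (d eps q x w : R) :
  0 < d -> d <= 2^-1 -> 4 * d <= eps -> 0 < q -> q <= x -> (1 - d / 4) * x <= w ->
  (1 + d) * q <= (1 + eps) * w.
Proof.
move=> d0 d2 de q0 qx xw.
have p1 : 0 <= 1 - d / 4 by lra.
have y3 : (1 - d / 4) * q <= w by apply: le_trans xw; rewrite ler_wpM2l.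
have y4 : (1 + 4 * d) * ((1 - d / 4) * q) <= (1 + eps) * w.
  apply: ler_pM => //; last by rewrite lerD2l.
    by lra.
  by rewrite mulr_ge0 // ltW.
apply: le_trans y4; rewrite !mulrA ler_pM2r //; nra.
Qed.

(* Cliques of size [m = (1 + 1 / g) * 2 ^ k], with [g] a power of 2, are what the upper
   bound excludes. *)
Lemma window_criterion (R : realType) (eps : R) i : 0 < eps -> exists g k,
  [/\ 1 < g, 128 <= k, 1000 * g * k ^ 4 <= 2 ^ k & (2 * k) ^ (4 * g) <= 2 ^ k]%N /\
  4 <= eps * g%:R /\
  forall n (c C : R), (2 * k <= n)%N -> (g.+1 * (n * k) <= g * (2 * 2 ^ k))%N ->
    (2 ^ k + k ^ 3 + k ^ 2 <= n * k)%N ->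
    c * (n%:R * log2 n%:R) < (2 ^ k)%:R ->
    (1 + g%:R^-1) * (2 ^ k)%:R <= C * (n%:R * log2 n%:R) ->
    (i < n)%N /\ 1 - i.+1%:R^-1 <= prob_omega_between c C n.
Proof.
move=> e0; have [a [a0 ha]] := large_power2 e0; set g := (2 ^ a)%N in ha.
have g1 : (1 < g)%N by rewrite /g -{1}(expn0 2) ltn_exp2l.
have g0 := ltnW g1.
have [k [l [b [[kl bl l0 iak] [big1 big2 big3 big4]]]]] := asymptotic_regime 134 (i + a) g0.
have k1 : (128 <= k)%N by rewrite kl leq_pmulr.
have ik : (i <= k)%N := leq_trans (leq_addr a i) iak.
have ak : (a <= k)%N := leq_trans (leq_addl i a) iak.
exists g, k; split=> //; split=> // n c C n2k up ge lo hi; split.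
  by apply: leq_trans n2k; rewrite mul2n -addnn -addn1 leq_add // (leq_trans _ k1).
pose m := (2 ^ k + 2 ^ (k - a))%N.
have gm : (g * 2 ^ (k - a) = 2 ^ k)%N by rewrite /g -expnD subnKC.
have mge : (g.+1 * 2 ^ k <= g * m)%N by rewrite /m mulnDr gm mulSn addnC.
have mle : (m <= 2 * 2 ^ k)%N by rewrite /m mul2n -addnn leq_add2l leq_exp2l // leq_subr.
have cnt := @omega_window_count n k l g 134 b m kl bl l0 g0 (leqnn _) n2k mle mge up ge big1 big2.
apply: le_trans (_ : 1 - k.+1%:R^-1 <= _).
  by rewrite lerD2l lerN2 lef_pV2 ?posrE ?ltr0n // ler_nat ltnS.
apply: prob_omega_window cnt _ _; rewrite -mulrA //.
have G0 : g%:R != 0 :> R by rewrite pnatr_eq0 -lt0n.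
suff -> : m%:R = (1 + g%:R^-1) * (2 ^ k)%:R :> R by [].
by rewrite /m natrD mulrDl mul1r -gm natrM mulrA mulVf // mul1r.
Qed.

Lemma half_window (R : realType) (eps : R) i : 0 < eps ->
  exists n, (i < n)%N /\ 1 - i.+1%:R^-1 <= prob_omega_between (2^-1) (2^-1 + eps) n.
Proof.
move=> e0; have [g [k [[g1 k1 big pow] [ge4 crit]]]] := window_criterion i e0.
have [n [up low ge n2k nle]] := sparse_order g1 k1 big.
exists n; have n0 : (0 < n)%N by apply: leq_trans n2k; rewrite muln_gt0 (leq_trans _ k1).
have n0' : 0 < n%:R :> R by rewrite ltr0n.
have G0 : 0 < g%:R :> R by rewrite ltr0n ltnW.
set d := g%:R^-1 : R.
have d0 : 0 < d by rewrite invr_gt0.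
have x0 : 0 < (n * k)%:R :> R by rewrite ltr0n muln_gt0 n0 (leq_trans _ k1).
have F1 : (1 - d / 4) * k%:R <= log2 n%:R.
  apply: log2_lower_fraction => //; first exact: ltnW.
  rewrite mulnCA; apply: leq_trans (leq_pmull _ (ltn0Sn 1)); apply: leq_trans ge.
  by rewrite -addnA leq_addr.
apply: (crit n) => //.
(* [n <= 2 ^ k] gives [log2 n <= k], and [n * k] is below [2 * 2 ^ k]. *)
- have xq : (n * k)%:R < 2 * (2 ^ k)%:R :> R.
    have F3 : (1 + d) * (n * k)%:R <= 2 * (2 ^ k)%:R.
      by rewrite -ler_ratio_l // natr1 -!natrM ler_nat.
    by apply: lt_le_trans F3; rewrite ltr_pMl // ltrDl.
  rewrite mulrC ltr_pdivrMr // [ltRHS]mulrC (le_lt_trans _ xq) // natrM ler_pM2l //.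
  by have := @log2_upper R n 1 k n0; rewrite expn1 mul1r; apply.
- apply: (@half_window_arith R d eps _ (n * k)%:R k%:R) => //.
  + by rewrite lef_pV2 ?posrE // ler_nat.
  + by rewrite /d ler_pdivrMr.
  + by rewrite -ler_ratio_r // natr1 -!natrM -natrD -!natrM ler_nat.
  + rewrite -(ler_pM2l G0) [leRHS]mulrA mulfV ?gt_eqF // mul1r -!natrM ler_nat.
    apply: leq_trans big; rewrite mulnCA mulnA leq_mul2l -{1}(expn1 k).
    by rewrite leq_pexp2l ?orbT // (leq_trans _ k1).
  + by rewrite natrM mulrCA ler_pM2l.
Qed.

Lemma full_window (R : realType) (eps : R) i : 0 < eps ->
  exists n, (i < n)%N /\ 1 - i.+1%:R^-1 <= prob_omega_between 1 (1 + eps) n.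
Proof.
move=> e0; have [g [k [[g1 k1 big pow] [ge4 crit]]]] := window_criterion i e0.
have [n [up nk6 ge n2k nle]] := dense_order g1 k1 big.
exists n; have n0 : (0 < n)%N by apply: leq_trans n2k; rewrite muln_gt0 (leq_trans _ k1).
have n0' : 0 < n%:R :> R by rewrite ltr0n.
have G0 : 0 < g%:R :> R by rewrite ltr0n ltnW.
set d := g%:R^-1 : R.
have d0 : 0 < d by rewrite invr_gt0.
have qx : (2 ^ k <= n * k)%N by apply: leq_trans ge; rewrite -addnA leq_addr.
have F1 : (1 - d / 4) * k%:R <= log2 n%:R.
  apply: log2_lower_fraction => //; first exact: ltnW.
  by rewrite mulnCA (leq_trans qx) // leq_pmull.
apply: (crit n) => //.
(* [n <= 2 ^ (k - 6)] gives [log2 n <= k - 6], and the saved [6 * n] covers the excess of [n * k]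
   over [2 ^ k]. *)
- rewrite mul1r; apply: (@le_lt_trans _ _ (n%:R * (k%:R - 6))).
    rewrite ler_pM2l //; have := @log2_upper R n 1 (k - 6) n0.
    by rewrite expn1 mul1r natrB; [exact|exact: leq_trans k1].
  by rewrite mulrBr ltrBlDr mulrC [n%:R * 6]mulrC -!natrM -natrD ltr_nat mulnC.
- apply: (@full_window_arith R d eps _ (n * k)%:R) => //.
  + by rewrite lef_pV2 ?posrE // ler_nat.
  + by rewrite /d ler_pdivrMr.
  + by rewrite ler_nat.
  + by rewrite natrM mulrCA ler_pM2l.
Qed.

(** For a suitable [n] the two probabilities add up to more than 1, so the windows cannot be
    disjoint. *)
Lemma window_threshold (R : realType) (c C c' C' : R) :
  (forall i, exists n, (i < n)%N /\ 1 - i.+1%:R^-1 <= prob_omega_between c' C' n) ->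
  (prob_omega_between c C n @[n --> \oo] --> (1 : R))%classic ->
  exists n x, [/\ (0 < n)%N, c * n%:R * log2 n%:R < x, x < C * n%:R * log2 n%:R,
    c' * n%:R * log2 n%:R < x & x < C' * n%:R * log2 n%:R].
Proof.
move=> often cvg1.
have half1 : (2^-1 : R) < 1 by lra.
have [N _ hN] := cvgr_gt _ cvg1 _ half1.
have [n [n3 hn]] := often (N + 3)%N; exists n.
have hP : 2^-1 < prob_omega_between c C n.
  by apply: hN; apply: leq_trans (ltnW n3); rewrite leq_addr.
have q4 : (N + 3).+1%:R^-1 <= 2^-1 :> R.
  by rewrite lef_pV2 ?posrE // ler_nat addnS.
apply/not_existsP => no.
suff : prob_omega_between c C n + prob_omega_between c' C' n <= 1.
  move: hP hn q4; move: (prob_omega_between c C n) (prob_omega_between c' C' n) => p p'.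
  by move: ((N + 3).+1%:R^-1 : R) => t; clear; lra.
apply: prob_omega_disjoint => x; apply/negP => /and4P[h1 h2 h3 h4].
by apply: (no x); split=> //; apply: leq_ltn_trans n3.
Qed.

Unset Implicit Arguments.
Set Strict Implicit.
Set Printing Implicit Defensive.
Local Open Scope classical_set_scope.
Local Open Scope ring_scope.

Theorem theorem1p2 (R : realType) :
  (forall eps : R, 0 < eps ->
     exists u v : nat -> nat,
       [/\ increasing_seq u, (forall i, (0 < u i)%N),
           increasing_seq v & (forall j, (0 < v j)%N)] /\
       ((fun i => prob_omega_between (2^-1) (2^-1 + eps) (u i)) @ \oo
          --> (1 : R)) /\
       ((fun j => prob_omega_between 1 (1 + eps) (v j)) @ \oo --> (1 : R))) /\
  (forall c C : R,
     prob_omega_between c C n @[n --> \oo] --> (1 : R) ->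
     c <= 2^-1 /\ 1 < C).
Proof.
split=> [eps e0|c C cvg1].
  have [u [incu u0 cvgu]] := fast_subsequence (@prob_omega_between_le1 R (2^-1) (2^-1 + eps))
    (fun i => half_window i e0).
  have [v [incv v0 cvgv]] := fast_subsequence (@prob_omega_between_le1 R 1 (1 + eps))
    (fun i => full_window i e0).
  by exists u, v.
split.
  (* If [c > 1 / 2], then [eps = c - 1 / 2] makes the upper edge of the first window the lower edge
     of the given one. *)
  rewrite leNgt; apply/negP => c2; have e0 : 0 < c - 2^-1 by rewrite subr_gt0.
  have [n [x [_ h1 _ _]]] := window_threshold (fun i => half_window i e0) cvg1.
  by rewrite subrKC => h2; move: (lt_trans h1 h2); rewrite ltxx.
(* If [C <= 1], the given window ends no later than the second window begins, as [n * log2 n] is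
   nonnegative. *)
rewrite ltNge; apply/negP => C1.
have [n [x [n0 _ h1 h2 _]]] := window_threshold (fun i => full_window i ltr01) cvg1.
have := lt_trans h2 h1; apply/negP; rewrite -leNgt -!mulrA ler_wpM2r // mulr_ge0 //.
have := @log2_lower R n 0 0 n0 (leqnn _).
by rewrite divr_ge0 // ln_ge0 // ler1n.
Qed.
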